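(* Let $X=\mathrm{Gr}(\mathtt i,n+1)=A_n/P_{\mathtt i}$. Fix $w\in W^{\mathfrak p}\setminus\{1,w_0\}$ with associated $\mathsf a=\mathsf a(w)$ and $\mathtt J=\mathtt J(w)$, and let $\varepsilon\in\Pi_{1,\mathsf a-1}$. Write $$\mathtt J(w)=\{\mathtt j_{\mathsf p}<\cdots<\mathtt j_1<\mathtt k_1<\cdots<\mathtt k_{\mathsf q}\}\quad\text{with}\quad \mathtt j_1<\mathtt i<\mathtt k_1,$$ and set $\mathtt j_{\mathsf p+1}=0$, $\mathtt j_0=\mathtt i=\mathtt k_0$, $\mathtt k_{\mathsf q+1}=n+1$. Then $\mathrm{codim}_{X_w}X_{w_\varepsilon}\ge3$. Equality holds if and only if there exist $0<\ell\le\mathsf p$ and $0<m\le\mathsf q$ such that $\ell+m=\mathsf a+1$ and $1=\mathtt j_\ell-\mathtt j_{\ell+1}=\mathtt k_{m+1}-\mathtt k_m$.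
   Context: Setting. $G$ is the complex simple Lie group of type $A_n$ (e.g. $\mathrm{SL}_{n+1}\mathbb C$) with Lie algebra $\mathfrak g$; Cartan and Borel subgroups $H\subset B$ are fixed, with Lie algebras $\mathfrak h\subset\mathfrak b$. $\Delta$ is the set of roots, $\Delta^\pm$ the positive/negative roots ($\mathfrak b$ is the sum of $\mathfrak h$ and the positive root spaces), $\mathfrak g_\alpha$ the root space of $\alpha$, $\Sigma=\{\alpha_1,\dots,\alpha_n\}$ the simple roots (standard labelling), and $\{Z_1,\dots,Z_n\}$ the basis of $\mathfrak h$ dual to $\Sigma$. Fix $\mathtt i\in\{1,\dots,n\}$. Put $\mathfrak g_k=\{A\in\mathfrak g\mid [Z_{\mathtt i},A]=kA\}$, so $\mathfrak g=\mathfrak g_1\oplus\mathfrak g_0\oplus\mathfrak g_{-1}$. $P=P_{\mathtt i}\supset B$ is the maximal parabolic subgroup with Lie algebra $\mathfrak p=\mathfrak g_1\oplus\mathfrak g_0$, $X=G/P$ is the Grassmannian of $\mathtt i$-planes in $\mathbb C^{n+1}$, and $o=P/P\in X$. For $\mathfrak s\subset\mathfrak g$ put $\Delta(\mathfrak s)=\{\alpha\in\Delta\mid\mathfrak g_\alpha\subset\mathfrak s\}$ and $\Delta^{+}(\mathfrak s)=\Delta(\mathfrak s)\cap\Delta^+$. Schubert varieties. $W$ is the Weyl group of $\mathfrak g$, $W_{\mathfrak p}$ the Weyl group of $\mathfrak g_0$, and $W^{\mathfrak p}$ the set of minimal length representatives of the cosets $W_{\mathfrak p}\backslash W$; $1$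 is the identity and $w_0$ the longest element of $W^{\mathfrak p}$. For $w\in W^{\mathfrak p}$, $X_w=\overline{Bw^{-1}\cdot o}\subset X$ is a Schubert variety and $\Delta(w)=w\Delta^-\cap\Delta^+\subset\Delta(\mathfrak g_1)$ is the inversion set of $w$ (which determines $w$). The data $\mathsf a(w),\mathtt J(w)$. For $w\in W^{\mathfrak p}\setminus\{1,w_0\}$ let $\mathfrak n_w=\bigoplus_{\alpha\in\Delta(w)}\mathfrak g_{-\alpha}\subset\mathfrak g_{-1}$, and let $\mathfrak q_w\subset\mathfrak g_0$ be the stabilizer of $\mathfrak n_w$ in $\mathfrak g_0$; it is a parabolic subalgebra of $\mathfrak g_0$ containing $\mathfrak h$ and the positive root spaces of $\mathfrak g_0$. Let $\mathtt J(w)\subset\{1,\dots,n\}\setminus\{\mathtt i\}$ be the set of $\mathtt j\neq\mathtt i$ with $\mathfrak g_{-\alpha_{\mathtt j}}\not\subset\mathfrak q_w$, put $Z_w=\sum_{\mathtt j\in\mathtt J(w)}Z_{\mathtt j}$ and $\mathfrak g_{k,\ell}=\{A\in\mathfrak g_k\mid [Z_w,A]=\ell A\}$. It is known that there is a unique integer $\mathsf a=\mathsf a(w)\ge0$ with $\Delta(w)=\{\alpha\in\Delta(\mathfrak g_1)\mid\alpha(Z_w)\le\mathsf a\}$, and that $\mathsf p,\mathsf q\in\{\mathsf a,\mathsf a+1\}$, where $\mathsf p$ (resp. $\mathsf q$) is the number of elements of $\mathtt J(w)$ smaller (resp. larger) than $\mathtt i$. Further definitions. $\Pi_{1,\mathsf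 a-1}=\{\varepsilon\in\Delta(\mathfrak g_{1,\mathsf a-1})\mid \varepsilon+\alpha\notin\Delta\ \forall\,\alpha\in\Delta^+(\mathfrak g_{0,0})\}$. For $\varepsilon\in\Pi_{1,\mathsf a-1}$ put $\Delta(w,\varepsilon)=\{\varepsilon\}\sqcup\{\nu\in\Delta(\mathfrak g_{1,\mathsf a})\mid \nu-\varepsilon\in\Delta(\mathfrak g_{0,1})\}$, and let $w_\varepsilon\in W^{\mathfrak p}$ be the (existing, unique) element with $\Delta(w_\varepsilon)=\Delta(w)\setminus\Delta(w,\varepsilon)$. The varieties $X_{w_\varepsilon}\subset X_w$ are the irreducible components of $\mathrm{Sing}(X_w)$.
   Formalization: For a fixed ε the equality criterion fails if X_w has several singular components; here (ℓ,m) must be the pair of ε, i.e. ε = α_{j_ℓ+1}+…+α_{k_m−1}, and the criterion as printed is proved for ''equality holds for some ε''. *)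

(* Defs.v *)
From HB Require Import structures.
From mathcomp Require Import all_boot all_order all_algebra all_fingroup.
From mathcomp Require Import boolp classical_sets.
From mathcomp Require mpoly.
Set Implicit Arguments.
Unset Strict Implicit.
Unset Printing Implicit Defensive.
Import Order.TTheory GRing.Theory Num.Theory.

(* C^{n+1} has coordinates 0, ..., n, while the simple roots (and everything
   indexed by them) keep their standard labels 1, ..., n. *)

Section WeylGroup.
Variable n : nat.

Definition simple_refl (j : nat) : 'S_n.+1 := tperm (inord j.-1) (inord j).

Definition word_of_size (w : 'S_n.+1) (k : nat) : bool :=
  [exists t : k.-tuple 'I_n, w == (\prod_(j <- t) simple_refl j.+1)%g].

Lemma word_of_size_exists (w : 'S_n.+1) : exists k, word_of_size w k.
Proof.
pose S : {set 'S_n.+1} := [set simple_refl (j : 'I_n).+1 | j : 'I_n]%SET.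
have adj m : m < n.+1 -> tperm ord0 (inord m) \in <<S>>%g.
  elim: m => [_|m IH lt_m].
    have -> : inord 0 = ord0 :> 'I_n.+1 by apply: val_inj; rewrite /= inordK.
    by rewrite tperm1 group1.
  have mS : tperm (inord m) (inord m.+1) \in <<S>>%g.
    by apply: mem_gen; apply/imsetP; exists (Ordinal (lt_m : m < n)).
  have [m0|mN0] := eqVneq m 0; first by subst m; move: mS;
    have -> : inord 0 = ord0 :> 'I_n.+1 by apply: val_inj; rewrite /= inordK.
  have d1 : ord0 != inord m.+1 :> 'I_n.+1.
    by rewrite -val_eqE /= inordK.
  have d2 : inord m != inord m.+1 :> 'I_n.+1.
    by rewrite -val_eqE /= !inordK ?ltn_eqF // ltnW.
  have d3 : ord0 != inord m :> 'I_n.+1.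
    by rewrite -val_eqE /= inordK ?(ltnW lt_m) // eq_sym.
  have -> : tperm ord0 (inord m.+1) =
            (tperm ord0 (inord m) ^ tperm (inord m) (inord m.+1))%g
            :> 'S_n.+1.
    by rewrite tpermJ tpermL tpermD // eq_sym.
  by apply: groupJ => //; apply: IH; exact: ltnW.
have : w \in <<S>>%g.
  suff -> : <<S>>%g = [set: 'S_n.+1]%SET by rewrite inE.
  apply/eqP; rewrite finset.eqEsubset finset.subsetT /= -(gen_tperm ord0) gen_subG.
  apply/fintype.subsetP => s /imsetP[y _ ->].
  by rewrite -[y]inord_val; apply: adj.
case/gen_prodgP => k [c cS ->]; exists k; apply/existsP.
have /fin_all_exists[f fE] x : exists j : 'I_n, c x = simple_refl j.+1.
  by have /imsetP[j _ ->] := cS x; exists j.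
exists [tuple f x | x < k]; apply/eqP.
rewrite big_tuple; apply: eq_bigr => x _; rewrite tnth_mktuple fE //.
Qed.

Definition weyl_length (w : 'S_n.+1) : nat := ex_minn (word_of_size_exists w).

Definition weyl_p (i : nat) : {set 'S_n.+1} :=
  (<<[set simple_refl (j : 'I_n).+1 | j : 'I_n & j.+1 != i]>>)%g.

(* Permutations multiply left to right in perm: [(w * u) x = u (w x)], so that
   the coset W_p w of the usual composition is the set of the [w * u]. *)
Definition min_rep (i : nat) (w : 'S_n.+1) : Prop :=
  forall u, u \in weyl_p i -> weyl_length w <= weyl_length (w * u)%g.

Definition longest_min_rep (i : nat) (w : 'S_n.+1) : Prop :=
  min_rep i w /\ forall v, min_rep i v -> weyl_length v <= weyl_length w.

End WeylGroup.

Local Open Scope ring_scope.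

Section Roots.
Variable n : nat.

(* The weight \sum_a c_a e_a, where e_a maps a diagonal matrix H to H_aa.
   A root has coordinate sum 0, and a functional on the traceless diagonal
   matrices has at most one expression with coordinate sum 0, so equality of
   vectors is equality in the dual of the Cartan subalgebra. *)
Definition weight := 'rV[int]_n.+1.

Definition eps (a : 'I_n.+1) : weight := delta_mx 0 a.

Definition roots : seq weight :=
  [seq eps ab.1 - eps ab.2 |
     ab : 'I_n.+1 * 'I_n.+1 <- enum {: 'I_n.+1 * 'I_n.+1} & ab.1 != ab.2].
Definition pos_roots : seq weight :=
  [seq eps ab.1 - eps ab.2 |
     ab : 'I_n.+1 * 'I_n.+1 <- enum {: 'I_n.+1 * 'I_n.+1} & (ab.1 < ab.2)%N].
Definition neg_roots : seq weight :=
  [seq eps ab.1 - eps ab.2 |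
     ab : 'I_n.+1 * 'I_n.+1 <- enum {: 'I_n.+1 * 'I_n.+1} & (ab.2 < ab.1)%N].

Definition simple_root (j : nat) : weight := eps (inord j.-1) - eps (inord j).

(* The linear action with w e_a = e_(w a). *)
Definition weyl_act (w : 'S_n.+1) (al : weight) : weight := col_perm w^-1%g al.

Definition inversions (w : 'S_n.+1) : seq weight :=
  [seq al <- [seq weyl_act w be | be <- neg_roots] | al \in pos_roots].

End Roots.

Local Open Scope classical_set_scope.

Section LieAlgebra.
Variables (C : numFieldType) (n : nat).
Implicit Types (i : nat) (w : 'S_n.+1).

Definition lie (A B : 'M[C]_n.+1) : 'M[C]_n.+1 := A *m B - B *m A.

Definition sl : set 'M[C]_n.+1 := [set A | \tr A = 0].
Definition cartan : set 'M[C]_n.+1 := [set H | sl H /\ is_diag_mx H].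

Definition weight_eval (al : weight n) (H : 'M[C]_n.+1) : C :=
  \sum_b (al 0 b)%:~R * H b b.

Definition root_space (al : weight n) : set 'M[C]_n.+1 :=
  [set A | sl A /\ forall H, cartan H -> lie H A = weight_eval al H *: A].

Definition Delta (s : set 'M[C]_n.+1) : set (weight n) :=
  [set al | al \in roots n /\ root_space al `<=` s].

Definition Zdual (j : nat) : 'M[C]_n.+1 :=
  diag_mx (\row_b ((b < j)%N%:R - j%:R / n.+1%:R)).

Lemma Zdual_cartan j : (j <= n.+1)%N -> cartan (Zdual j).
Proof.
move=> le_j; split; last exact: diag_mx_is_diag.
rewrite /sl /= mxtrace_diag; under eq_bigr do rewrite mxE.
rewrite sumrB sumr_const card_ord -[_ *+ n.+1]mulr_natr divfK ?pnatr_eq0 //.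
rewrite -natr_sum -[j in X in _ - X]card_ord -sum1_card.
rewrite (big_ord_widen n.+1 (fun=> 1%N)) //.
by rewrite [in X in _ - X]big_mkcond subrr.
Qed.

Lemma simple_root_Zdual j k : (0 < j <= n)%N -> (0 < k <= n)%N ->
  weight_eval (simple_root n k) (Zdual j) = (k == j)%:R.
Proof.
move=> /andP[j0 jn] /andP[k0 kn].
have lt1 : (k.-1 < n.+1)%N by rewrite ltnS (leq_trans (leq_pred k)).
have sumE (a : 'I_n.+1) (f : 'I_n.+1 -> C) :
    \sum_b (eps a 0 b)%:~R * f b = f a.
  rewrite (bigD1 a) //= mxE !eqxx mul1r big1 ?addr0 // => b ba.
  by rewrite mxE eqxx (negPf ba) mul0r.
rewrite /weight_eval; under eq_bigr do
  rewrite mxE [X in _ + X]mxE rmorphD rmorphN mulrDl mulNr.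
rewrite sumrB !sumE !mxE !eqxx !mulr1n !inordK // opprB addrA subrK.
case: k k0 kn lt1 => // k _ _ _ /=.
rewrite [(k < j)%N]leq_eqVlt.
by case: (ltngtP k.+1 j) => _; rewrite ?subrr ?subr0.
Qed.

Definition grade i (k : int) : set 'M[C]_n.+1 :=
  [set A | sl A /\ lie (Zdual i) A = k%:~R *: A].

Definition nil_w w : set 'M[C]_n.+1 :=
  [set A | exists F : weight n -> 'M[C]_n.+1,
     (forall al, al \in inversions w -> root_space (- al) (F al)) /\
     A = \sum_(al <- inversions w) F al].

Definition stab_w i w : set 'M[C]_n.+1 :=
  [set A | grade i 0 A /\ forall N, nil_w w N -> nil_w w (lie A N)].

Definition J_w i w : set nat :=
  [set j | [/\ (0 < j <= n)%N, j <> i &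
               ~ (root_space (- simple_root n j) `<=` stab_w i w)]].

Definition Z_w i w : 'M[C]_n.+1 :=
  \sum_(1 <= j < n.+1 | `[< J_w i w j >]) Zdual j.

Definition bigrade i w (k l : int) : set 'M[C]_n.+1 :=
  [set A | grade i k A /\ lie (Z_w i w) A = l%:~R *: A].

Definition is_a_w i w (a : nat) : Prop :=
  [set al | al \in inversions w] =
  [set al | Delta (grade i 1) al /\ weight_eval al (Z_w i w) <= a%:R].

Definition Pi_w i w (a : nat) : set (weight n) :=
  [set e | Delta (bigrade i w 1 (a%:Z - 1)) e /\
     forall al, Delta (bigrade i w 0 0) al -> al \in pos_roots n ->
       e + al \notin roots n].

Definition Delta_w_eps i w (a : nat) (e : weight n) : set (weight n) :=
  e |` [set nu | Delta (bigrade i w 1 a) nu /\ Delta (bigrade i w 0 1) (nu - e)].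

Definition is_w_eps i w (a : nat) (e : weight n) (v : 'S_n.+1) : Prop :=
  min_rep i v /\
  [set al | al \in inversions v] =
  [set al | al \in inversions w] `\` Delta_w_eps i w a e.

(* Reads J as j_p < ... < j_1 < i < k_1 < ... < k_q, together with the
   conventions j_0 = k_0 = i, j_(p+1) = 0 and k_(q+1) = n+1. *)
Definition enumerates i (J : set nat) (p q : nat) (j k : nat -> nat) : Prop :=
  [/\ j 0%N = i /\ k 0%N = i,
      j p.+1 = 0%N /\ k q.+1 = n.+1,
      forall l, (l <= p)%N -> (j l.+1 < j l)%N,
      forall m, (m <= q)%N -> (k m < k m.+1)%N &
      J = [set x | exists2 l, (0 < l <= p)%N & x = j l] `|`
          [set x | exists2 m, (0 < m <= q)%N & x = k m]].

End LieAlgebra.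

Section SchubertVarieties.
Variables (C : fieldType) (n : nat).
Implicit Types (i : nat) (w : 'S_n.+1).

Definition SL : set 'M[C]_n.+1 := [set g | \det g = 1].
Definition borel : set 'M[C]_n.+1 :=
  [set b | SL b /\ forall s t : 'I_n.+1, (t < s)%N -> b s t = 0].

Definition cspace := {vspace 'cV[C]_n.+1}.
Definition act (g : 'M[C]_n.+1) (U : cspace) : cspace :=
  (linfun (mulmx g) @: U)%VS.

(* The point v.o of the Grassmannian for a Weyl group element v, that is, the
   span of the v(e_t) for the first i coordinate vectors e_t. *)
Definition weyl_point i (v : 'S_n.+1) : cspace :=
  <<[seq delta_mx (v t) 0%R | t : 'I_n.+1 <- enum 'I_n.+1 & (t < i)%N]>>%VS.
Definition base_point i : cspace := weyl_point i 1%g.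

Definition Gr i : set cspace := [set U | \dim U = i].

Definition mx_zero_locus (S : set (mpoly.mpoly (n.+1 * n.+1) C))
  : set 'M[C]_n.+1 :=
  [set g | forall f, S f -> mpoly.meval (fun k => mxvec g 0 k) f = 0].

(* Zariski topology of G/P, as the quotient of that of G = SL_(n+1) by the
   orbit map g |-> g.o onto the Grassmannian. *)
Definition zclosed i (Y : set cspace) : Prop :=
  Y `<=` Gr i /\
  exists S, [set g | SL g /\ Y (act g (base_point i))] =
            SL `&` mx_zero_locus S.

Definition zclosure i (Y : set cspace) : set cspace :=
  [set U | Gr i U /\ forall Y', zclosed i Y' -> Y `<=` Y' -> Y' U].

Definition zirreducible i (Y : set cspace) : Prop :=
  Y !=set0 /\
  forall Y1 Y2, zclosed i Y1 -> zclosed i Y2 -> Y `<=` Y1 `|` Y2 ->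
    Y `<=` Y1 \/ Y `<=` Y2.

Definition zchain i (Y Y' : set cspace) (c : nat) : Prop :=
  exists T : nat -> set cspace,
    [/\ T 0%N = Y, T c = Y',
        forall k, (k <= c)%N -> zclosed i (T k) /\ zirreducible i (T k) &
        forall k, (k < c)%N -> T k `<` T k.+1].

Definition is_codim i (Y Y' : set cspace) (c : nat) : Prop :=
  zchain i Y Y' c /\ forall c', zchain i Y Y' c' -> (c' <= c)%N.

Definition schubert i w : set cspace :=
  zclosure i [set U | exists2 b, borel b & U = act b (weyl_point i w^-1%g)].

End SchubertVarieties.
Arguments schubert C {n} i w.

(* Main.v *)
Require Import Defs.
From mathcomp Require Import all_boot all_order all_algebra all_fingroup.
From mathcomp Require Import boolp classical_sets reals.
From mathcomp Require Import complex.
From mathcomp Require Import mpoly.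
From mathcomp Require Import zify ring.
Set Implicit Arguments.
Unset Strict Implicit.
Unset Printing Implicit Defensive.
Import Order.TTheory GRing.Theory Num.Theory.
Local Open Scope ring_scope.

(** In the Grassmannian of i-planes the orbits of the Borel group are the
    cells of echelon matrices of a given shape s_0 < ... < s_(i-1), the rows of
    the leading entries.  The cell of w has the shape s_k = w^-1(k) and is an
    affine space with one coordinate per inversion of w.  The proof has two
    halves: the codimension of X_v in X_w is the number of inversions of w that
    are not inversions of v (schubert_codim), and for v = w_eps this number is
    read off a picture of Delta(w).

    Codimension.  A chain of Schubert varieties of the right length is found by
    raising one leading row by one at a time (shape_step_proper); each step is
    an inclusion because a cell is a limit of cells of the next shape, and is
    strict because a minor separates them.  That no chain of irreducible closed
    sets is longer is shown by counting functions.  Closed sets are cut out by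
    forms, the polynomials in a matrix of i columns that only get multiplied by
    a power of det h when the columns are changed by h (closed_separation).  If
    Y is properly contained in Y', choose a form P vanishing on Y but not on Y',
    and a form Q of the same weight that does not vanish on Y.  When a family of
    forms b is linearly independent on Y, all products b P^j Q^(d-j) with
    0 <= j <= d are independent on Y': divide a relation by the least power of P
    that occurs and restrict it to Y (independent_step).  Hence each step of a
    chain multiplies the number of independent forms by d+1, while their degrees
    stay linear in d.  Starting with the coordinate subspaces of the cell of v,
    a chain of length c from X_v to X_w provides (d+1)^(l(v)+c) independent
    forms on X_w.  On the cell of w they are polynomials of degree O(d) in each
    of l(w) variables, and there are only O(d^l(w)) of those, so that
    l(v) + c <= l(w) (growth_leq, zchain_leq).

    The picture.  Rows are indexed by 0 <= x < i and columns by i <= y <= n, the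
    root e_x - e_y being the box (x, y).  Then Delta(w) is a Young diagram with
    its corner at (i-1, i), and an element of J(w) separates two rows, or two
    columns, of different lengths (J_w_corner).  Thus J(w) cuts the rows into
    blocks j_(l+1) <= x < j_l and the columns into blocks k_m <= y < k_(m+1);
    Z_w has the value l + m on the block (l, m) (height_row, height_column), and
    Delta(w) is the staircase l + m <= a.  An element of Pi_(1,a-1) is the box
    of a block with l + m = a - 1 that is farthest from the corner of the
    diagram, which is (j_L, k_M - 1) with L = l+1, M = m+1 and L + M = a + 1
    (Pi_w_corner).  The set Delta(w, eps) is the hook formed by this box, the
    boxes of its column in the next block of rows, and the boxes of its row in
    the next block of columns (Delta_w_epsP).  Therefore the codimension is
    1 + (j_L - j_(L+1)) + (k_(M+1) - k_M).  Both differences are positive, so it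
    is at least 3, with equality if and only if both are 1. *)

(** * Polynomial functions and forms on frames *)

Section Frames.
Variables (C : numFieldType) (n i : nat).
Hypothesis le_in : (i <= n)%N.
Local Notation frame := 'M[C]_(n.+1, i).

(** The ring generated by the matrix entries, presented as an inductive
    predicate on functions: every use below is an induction on how the
    polynomial is built. *)
Inductive polyfun : (frame -> C) -> Prop :=
| polyfun_entry t k : polyfun (fun A => A t k)
| polyfun_const c : polyfun (fun=> c)
| polyfun_add P Q : polyfun P -> polyfun Q -> polyfun (fun A => P A + Q A)
| polyfun_mul P Q : polyfun P -> polyfun Q -> polyfun (fun A => P A * Q A).

Lemma polyfun_ext P Q : P =1 Q -> polyfun P -> polyfun Q.
Proof. by move=> /funext ->. Qed.

Lemma polyfun_sum (I : Type) (r : seq I) (D : pred I) (F : I -> frame -> C) :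
  (forall x, polyfun (F x)) -> polyfun (fun A => \sum_(x <- r | D x) F x A).
Proof.
move=> HF; elim: r => [|x r IH].
  by apply: (polyfun_ext _ (polyfun_const 0)) => A; rewrite big_nil.
case: (boolP (D x)) => Dx.
  apply: (polyfun_ext _ (polyfun_add (HF x) IH)) => A.
  by rewrite big_cons Dx.
by apply: (polyfun_ext _ IH) => A; rewrite big_cons (negPf Dx).
Qed.

Lemma polyfun_prod (I : Type) (r : seq I) (D : pred I) (F : I -> frame -> C) :
  (forall x, polyfun (F x)) -> polyfun (fun A => \prod_(x <- r | D x) F x A).
Proof.
move=> HF; elim: r => [|x r IH].
  by apply: (polyfun_ext _ (polyfun_const 1)) => A; rewrite big_nil.
case: (boolP (D x)) => Dx.
  apply: (polyfun_ext _ (polyfun_mul (HF x) IH)) => A.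
  by rewrite big_cons Dx.
by apply: (polyfun_ext _ IH) => A; rewrite big_cons (negPf Dx).
Qed.

Lemma polyfun_exp P e : polyfun P -> polyfun (fun A => P A ^+ e).
Proof.
move=> HP; elim: e => [|e IH]; first exact: polyfun_const.
by apply: (polyfun_ext _ (polyfun_mul HP IH)) => A; rewrite exprS.
Qed.

Lemma polyfun_mulmx a b c (F : frame -> 'M[C]_(a, b)) (G : frame -> 'M[C]_(b, c)) :
  (forall x y, polyfun (fun A => F A x y)) ->
  (forall x y, polyfun (fun A => G A x y)) ->
  forall x y, polyfun (fun A => (F A *m G A) x y).
Proof.
move=> HF HG x y.
apply: (@polyfun_ext (fun A => \sum_z F A x z * G A z y)).
  by move=> A; rewrite mxE.
by apply: polyfun_sum => z; apply: polyfun_mul.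
Qed.

Lemma polyfun_det a (F : frame -> 'M[C]_a) :
  (forall x y, polyfun (fun A => F A x y)) -> polyfun (fun A => \det (F A)).
Proof.
move=> HF; apply: polyfun_sum => s; apply: polyfun_mul.
  exact: polyfun_const.
by apply: polyfun_prod.
Qed.

Lemma polyfun_adj a (F : frame -> 'M[C]_a) :
  (forall x y, polyfun (fun A => F A x y)) ->
  forall x y, polyfun (fun A => (\adj (F A)) x y).
Proof.
move=> HF x y; apply: (@polyfun_ext (fun A => cofactor (F A) y x)).
  by move=> A; rewrite mxE.
apply: polyfun_mul; first exact: polyfun_const.
apply: polyfun_det => u v.
by apply: (@polyfun_ext (fun A => F A (lift y u) (lift x v))) => // A; rewrite !mxE.
Qed.

(** Transfers properties to the polynomials of the Zariski topology, whose
    variables are the entries of a square matrix, without ever manipulating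
    monomials. *)
Lemma meval_closed (T : Type) N (K : (T -> C) -> Prop) (x : T -> 'I_N -> C) (f : mpoly.mpoly N C) :
  (forall c, K (fun=> c)) ->
  (forall P Q, K P -> K Q -> K (fun t => P t + Q t)) ->
  (forall P Q, K P -> K Q -> K (fun t => P t * Q t)) ->
  (forall k, K (fun t => x t k)) ->
  K (fun t => mpoly.meval (x t) f).
Proof.
move=> Kc Ka Km Kx.
have Kext P Q : P =1 Q -> K P -> K Q by move=> /funext ->.
have Kexp P e : K P -> K (fun t => P t ^+ e).
  move=> HP; elim: e => [|e IH]; first exact: Kc.
  by apply: (Kext _ _ _ (Km _ _ HP IH)) => t; rewrite exprS.
have -> : (fun t => mpoly.meval (x t) f) = fun t =>
    \sum_(m <- mpoly.msupp f) mpoly.mcoeff m f * \prod_k x t k ^+ mpoly.fun_of_multinom m k.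
  by apply/funext => t; rewrite mpoly.mevalE.
elim: (mpoly.msupp f) => [|m r IH].
  by apply: (Kext _ _ _ (Kc 0)) => t; rewrite big_nil.
have Kprod (s : seq 'I_N) : K (fun t => \prod_(k <- s) x t k ^+ mpoly.fun_of_multinom m k).
  elim: s => [|k s IHs]; first by apply: (Kext _ _ _ (Kc 1)) => t; rewrite big_nil.
  apply: (Kext _ _ _ (Km _ _ (Kexp _ (mpoly.fun_of_multinom m k) (Kx k)) IHs)) => t.
  by rewrite big_cons.
apply: (Kext _ _ _ (Ka _ _ (Km _ _ (Kc _) (Kprod (index_enum _))) IH)) => t.
by rewrite big_cons.
Qed.

Lemma polyfun_line P (A B : frame) : polyfun P ->
  exists p : {poly C}, forall t, p.[t] = P (A + t *: B).
Proof.
elim=> [t k|c|{}P Q _ [p Hp] _ [q Hq]|{}P Q _ [p Hp] _ [q Hq]].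
- exists ((A t k)%:P + B t k *: 'X) => x.
  by rewrite !hornerE !mxE /= mulrC.
- by exists c%:P => x; rewrite hornerE.
- by exists (p + q) => x; rewrite hornerD Hp Hq.
- by exists (p * q) => x; rewrite hornerM Hp Hq.
Qed.

Definition cols (g : 'M[C]_n.+1) : frame := g *m pid_mx i.

Lemma colsE g t (k : 'I_i) : cols g t k = g t (widen_ord (leqW le_in) k).
Proof.
rewrite mxE (bigD1 (widen_ord (leqW le_in) k)) //= big1 => [|u uk].
  by rewrite mxE /= eqxx ltn_ord mulr1 addr0.
rewrite mxE; case: eqP => // E; last by rewrite mulr0.
by case/eqP: uk; apply: val_inj.
Qed.

Lemma polyfun_mpoly P : polyfun P ->
  exists f : mpoly.mpoly (n.+1 * n.+1) C, forall g,
    mpoly.meval (fun k => mxvec g 0 k) f = P (cols g).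
Proof.
elim=> [t k|c|{}P Q _ [p Hp] _ [q Hq]|{}P Q _ [p Hp] _ [q Hq]].
- exists (mpoly.mpolyX _ (mpoly.mnm1 (mxvec_index t (widen_ord (leqW le_in) k)))) => g.
  by rewrite mpoly.mevalXU mxvecE colsE.
- by exists (mpoly.mpolyC _ c) => g; rewrite mpoly.mevalC.
- by exists (p + q) => g; rewrite mpoly.mevalD Hp Hq.
- by exists (p * q) => g; rewrite mpoly.mevalM Hp Hq.
Qed.

(** A section of the r-th power of the ample generator of the Picard group of
    the Grassmannian, seen as a function on matrices.  Vanishing of a form
    depends only on the span of the columns. *)
Definition form (r : nat) (P : frame -> C) : Prop :=
  polyfun P /\ forall A (h : 'M_i), h \in unitmx -> P (A *m h) = \det h ^+ r * P A.

Lemma form_const c : form 0 (fun=> c).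
Proof. by split; [apply: polyfun_const|move=> A h _; rewrite mul1r]. Qed.

Lemma form_mul r r' P Q : form r P -> form r' Q -> form (r + r') (fun A => P A * Q A).
Proof.
move=> [pP hP] [pQ hQ]; split; first exact: polyfun_mul.
by move=> A h uh; rewrite hP // hQ // exprD mulrACA.
Qed.

Lemma form_sum (I : finType) (D : pred I) r (F : I -> frame -> C) :
  (forall x, D x -> form r (F x)) -> form r (fun A => \sum_(x | D x) F x A).
Proof.
move=> HF; split.
  apply: (@polyfun_ext (fun A => \sum_x (if D x then F x A else 0))).
    by move=> A; rewrite [RHS]big_mkcond.
  apply: polyfun_sum => x; case: (boolP (D x)) => [/HF[]//|_]; exact: polyfun_const.
move=> A h uh; rewrite mulr_sumr; apply: eq_bigr => x Dx.
by have [_ ->] := HF x Dx.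
Qed.

Lemma form_scale r c P : form r P -> form r (fun A => c * P A).
Proof. by move=> HP; rewrite -[r]add0n; apply: form_mul => //; apply: form_const. Qed.

Lemma form_exp r e P : form r P -> form (r * e) (fun A => P A ^+ e).
Proof.
move=> [pP hP]; split; first exact: polyfun_exp.
by move=> A h uh; rewrite hP // exprMn exprM.
Qed.

Lemma form_minor (f : 'I_i -> 'I_n.+1) : form 1 (fun A => \det (rowsub f A)).
Proof.
split; last by move=> A h _; rewrite -mul_rowsub_mx det_mulmx mulrC expr1.
apply: polyfun_det => x y; apply: (polyfun_ext _ (polyfun_entry (f x) y)) => A.
by rewrite mxE.
Qed.

(** * Frames and points of the Grassmannian *)

Definition span_of (A : frame) : cspace C n := (linfun (mulmx A) @: fullv)%VS.

Lemma span_ofP A (x : 'cV[C]_n.+1) : reflect (exists y, x = A *m y) (x \in span_of A).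
Proof.
apply: (iffP memv_imgP) => [[y _ ->]|[y ->]]; exists y; rewrite ?lfunE ?memvf //.
Qed.

Lemma span_of_mulP A B : (span_of A <= span_of B)%VS <-> exists h, A = B *m h.
Proof.
split=> [/subvP sAB|[h ->]]; last first.
  by apply/subvP => x /span_ofP[y ->]; apply/span_ofP; exists (h *m y); rewrite mulmxA.
have /fin_all_exists[f fE] (k : 'I_i) : exists y, col k A = B *m y.
  apply/span_ofP/sAB/span_ofP; exists (delta_mx k 0).
  by rewrite colE.
exists (\matrix_(l, k) f k l 0); apply/matrixP => t k.
have /matrixP/(_ t 0) := fE k; rewrite !mxE => ->.
by apply: eq_bigr => l _; rewrite mxE.
Qed.

Lemma span_of_unit A h : h \in unitmx -> span_of (A *m h) = span_of A.
Proof.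
move=> uh; apply/eqP; rewrite eqEsubv; apply/andP; split.
  by apply/span_of_mulP; exists h.
by apply/span_of_mulP; exists (invmx h); rewrite mulmxK.
Qed.

(** A left inverse is the form of linear independence of the columns that is
    preserved by the computations below; isframe_dim shows that it is implied by
    the dimension of the span. *)
Definition isframe (A : frame) := exists B, B *m A = 1%:M.

Lemma span_of_eq A B : isframe A -> span_of A = span_of B ->
  exists2 h, h \in unitmx & A = B *m h.
Proof.
move=> [L LA] eAB.
have [h hE] : exists h, A = B *m h by apply/span_of_mulP; rewrite eAB.
exists h => //; move: LA; rewrite hE mulmxA => /mulmx1_unit[_].
by [].
Qed.

Lemma dim_cV : \dim (fullv : {vspace 'cV[C]_i}) = i.
Proof. by rewrite dimvf /dim /= muln1. Qed.

Lemma dim_span_of A : isframe A -> \dim (span_of A) = i.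
Proof.
move=> [L LA]; rewrite /span_of limg_dim_eq; first exact: dim_cV.
apply/eqP; rewrite -subv0; apply/subvP => x; rewrite memv_cap memv_ker.
case/andP => _ /eqP; rewrite lfunE /= => Ax.
by rewrite memv0 -[x]mul1mx -LA -mulmxA Ax mulmx0.
Qed.

Lemma isframe_dim A : \dim (span_of A) = i -> isframe A.
Proof.
move=> dA; have rA : row_free A^T.
  rewrite -kermx_eq0; apply/rowV0P => v /sub_kermxP vA.
  apply/eqP/negPn/negP => v0.
  have : (\dim (fullv :&: lker (linfun (mulmx A))) + \dim (span_of A))%N =
         \dim (fullv : {vspace 'cV[C]_i}) := limg_ker_dim _ _.
  rewrite dA dim_cV => /eqP; rewrite -[X in _ == X]add0n eqn_add2r dimv_eq0.
  apply/negP; apply: contraNneq v0 => E.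
  have : v^T \in (fullv :&: lker (linfun (mulmx A)))%VS.
    by rewrite memv_cap memvf memv_ker lfunE /= -[A]trmxK -trmx_mul vA trmx0.
  by rewrite E memv0 trmx_eq0.
have /row_freeP[B HB] := rA.
by exists B^T; rewrite -[LHS]trmxK trmx_mul !trmxK HB trmx1.
Qed.

Lemma isframe_cols g : g \in unitmx -> isframe (cols g).
Proof.
move=> ug; exists (pid_mx i *m invmx g).
rewrite mulmxA -(mulmxA _ _ g) mulVmx // mulmx1 mul_pid_mx minnn.
by rewrite (minn_idPr _) ?pid_mx_1 // leqW.
Qed.

Lemma Gr_span U : Gr i U -> exists A, U = span_of A.
Proof.
move=> dU; rewrite /Gr /= in dU.
pose X := vbasis U.
exists (\matrix_(t, k) (X`_k : 'cV[C]_n.+1) t 0).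
apply/eqP; rewrite eqEsubv; apply/andP; split; apply/subvP => x.
  move=> /coord_vbasis ->; apply: memv_suml => k _; apply: memvZ.
  have lk : (k < i)%N by rewrite -dU ltn_ord.
  apply/span_ofP; exists (delta_mx (Ordinal lk) 0); rewrite -colE.
  by apply/colP => t; rewrite !mxE /=.
move=> /span_ofP[y ->].
have -> : \matrix_(t, k) (X`_k : 'cV[C]_n.+1) t 0 *m y = \sum_(k < i) y k 0 *: (X`_k : 'cV[C]_n.+1).
  apply/colP => t; rewrite !mxE summxE; apply: eq_bigr => k _.
  by rewrite !mxE mulrC.
apply: memv_suml => k _; apply: memvZ; apply: vbasis_mem; apply: mem_nth.
by rewrite size_tuple dU.
Qed.

(** SL acts transitively: a basis of U is completed to an invertible matrix,
    and the last column, which does not count as i <= n, is rescaled to make the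
    determinant 1. *)
Lemma Gr_SL U : Gr i U -> exists2 g, SL g & U = span_of (cols g).
Proof.
move=> gU; have [A UA] := Gr_span gU.
have [L LA] : isframe A by apply: isframe_dim; rewrite -UA.
have rA : \rank A = i.
  apply/eqP; rewrite eqn_leq rank_leq_col /=.
  by rewrite -{1}(mxrank1 C i) -LA; apply: mxrankM_maxr.
pose g := col_ebase A.
have ug : g \in unitmx by exact: col_ebase_unit.
pose d : 'rV[C]_n.+1 := \row_t (if t == ord_max then (\det g)^-1 else 1).
exists (g *m diag_mx d).
  rewrite /SL /= det_mulmx det_diag (bigD1 ord_max) //= big1 => [|t tn]; last first.
    by rewrite mxE (negPf tn).
  rewrite mxE eqxx mulr1 divff //; move: ug; rewrite unitmxE unitfE //.
have -> : cols (g *m diag_mx d) = cols g.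
  apply/matrixP => t k; rewrite !colsE mul_mx_diag !mxE.
  case: eqP => [/(congr1 val)/= E|_]; last by rewrite mulr1.
  by have := leq_trans (ltn_ord k) le_in; rewrite E ltnn.
rewrite UA -{1}(mulmx_ebase A) rA; apply: span_of_unit; exact: row_ebase_unit.
Qed.

Lemma act_span g A : Defs.act g (span_of A) = span_of (g *m A).
Proof.
apply/vspaceP => x; apply/idP/idP.
  case/memv_imgP => z /span_ofP[y ->] ->; rewrite lfunE /= mulmxA.
  by apply/span_ofP; exists y.
case/span_ofP => y ->; apply/memv_imgP; exists (A *m y); last by rewrite lfunE /= mulmxA.
by apply/span_ofP; exists y.
Qed.

Lemma weyl_point_span (v : 'S_n.+1) :
  weyl_point C i v = span_of (\matrix_(t, k) (t == v (widen_ord (leqW le_in) k))%:R).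
Proof.
apply/eqP; rewrite eqEsubv; apply/andP; split.
  apply/span_subvP => x /mapP[t]; rewrite mem_filter => /andP[ti _] ->.
  apply/span_ofP; exists (delta_mx (Ordinal ti) 0); rewrite -colE.
  apply/colP => u; rewrite !mxE andbT; congr (_ == v _)%:R; exact: val_inj.
apply/subvP => x /span_ofP[y ->].
have -> : \matrix_(t, k) (t == v (widen_ord (leqW le_in) k))%:R *m y =
    \sum_(k < i) y k 0 *: (delta_mx (v (widen_ord (leqW le_in) k)) 0 : 'cV[C]_n.+1).
  apply/colP => t; rewrite !mxE summxE; apply: eq_bigr => k _.
  by rewrite !mxE andbT mulrC.
apply: memv_suml => k _; apply/memvZ/memv_span/mapP.
by exists (widen_ord (leqW le_in) k); rewrite // mem_filter /= ltn_ord mem_enum.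
Qed.

Lemma base_point_span : base_point C n i = span_of (pid_mx i).
Proof.
rewrite /base_point weyl_point_span; congr span_of.
apply/matrixP => t k; rewrite !mxE perm1 -val_eqE /=; case: eqP => //= ->.
by rewrite ltn_ord.
Qed.

Lemma act_base g : Defs.act g (base_point C n i) = span_of (cols g).
Proof. by rewrite base_point_span act_span. Qed.

Lemma SL_unit (g : 'M[C]_n.+1) : SL g -> g \in unitmx.
Proof. by rewrite /SL /= unitmxE => ->; rewrite unitr1. Qed.

End Frames.
Arguments polyfun_const {C n i} c.
Arguments polyfun_entry {C n i} t k.
Arguments form_const {C n i} c.

(** * Closed subsets are cut out by forms *)

Section ClosedSets.
Variables (C : numFieldType) (n i : nat).
Hypothesis le_in : (i <= n)%N.
Local Notation frame := 'M[C]_(n.+1, i).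

(** The case a = 0 is the reason for working with the exponent r.+1: then both
    sides are 0, whatever x and y are. *)
Lemma homogeneous_rescale (a d e x y : C) r : e = a * d -> (a != 0 -> x = y) ->
  e ^+ r.+1 * x = d ^+ r.+1 * (a ^+ r.+1 * y).
Proof.
move=> ->; have [->|a0 ->//] := eqVneq a 0.
  by rewrite mul0r exprS !mul0r mulr0.
by rewrite exprMn mulrAC mulrC mulrA.
Qed.

(** The affine chart of the Grassmannian centred at the span of the first i
    columns of g1 consists of the spans of the matrices A such that the top
    square block T of g1^-1 A is invertible.  On it, chart_section chooses the
    representative in SL that is g1 times a lower unitriangular matrix. *)

Section Chart.
Variable g1 : 'M[C]_n.+1.
Hypothesis ug : g1 \in unitmx.

Definition chart_top (A : frame) : 'M[C]_i := pid_mx i *m (invmx g1 *m A).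
Definition chart_det A := \det (chart_top A).
Definition chart_num (A : frame) : 'M[C]_n.+1 :=
  g1 *m (copid_mx i *m (invmx g1 *m A) *m \adj (chart_top A) *m pid_mx i).
Definition chart_section A := g1 + (chart_det A)^-1 *: chart_num A.

Lemma chart_topM A h : chart_top (A *m h) = chart_top A *m h.
Proof. by rewrite /chart_top !mulmxA. Qed.

Lemma polyfun_chart_top x y : polyfun (fun A => chart_top A x y).
Proof.
apply: polyfun_mulmx => {x y} x y; first exact: polyfun_const.
apply: polyfun_mulmx => {x y} x y; first exact: polyfun_const.
exact: polyfun_entry.
Qed.

Lemma polyfun_chart_det : polyfun chart_det.
Proof. by apply: polyfun_det; apply: polyfun_chart_top. Qed.

Lemma polyfun_chart_num x y : polyfun (fun A => chart_num A x y).
Proof.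
apply: polyfun_mulmx => {x y} x y; first exact: polyfun_const.
apply: polyfun_mulmx => {x y} x y; last exact: polyfun_const.
apply: polyfun_mulmx => {x y} x y; last by apply: polyfun_adj; apply: polyfun_chart_top.
apply: polyfun_mulmx => {x y} x y; first exact: polyfun_const.
apply: polyfun_mulmx => {x y} x y; first exact: polyfun_const.
exact: polyfun_entry.
Qed.

Lemma chart_numE A : chart_det A != 0 -> (chart_det A)^-1 *: chart_num A =
  g1 *m (copid_mx i *m (invmx g1 *m A) *m invmx (chart_top A) *m pid_mx i).
Proof.
move=> D0; have -> : invmx (chart_top A) = (chart_det A)^-1 *: \adj (chart_top A).
  by rewrite /invmx unitmxE unitfE -/(chart_det A) D0.
rewrite /chart_num.
by rewrite -!(scalemxAr, scalemxAl).
Qed.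

Lemma chart_section_SL A : SL g1 -> chart_det A != 0 -> SL (chart_section A).
Proof.
move=> Sg D0; rewrite /SL /= /chart_section chart_numE //.
rewrite -{1}[g1]mulmx1 -mulmxDr det_mulmx Sg mul1r.
set N := _ *m pid_mx i; have N0 (t u : 'I_n.+1) : (t <= u)%N -> N t u = 0.
  move=> tu; case: (ltnP t i) => ti.
    rewrite /N -!mulmxA mxE big1 // => l _; rewrite !mxE.
    by rewrite ti andbT subrr mul0r.
  rewrite /N mxE big1 // => l _; rewrite !mxE.
  case: eqP => [E|_]; last by rewrite mulr0.
  by move: (ltn_ord l); rewrite E ltnNge (leq_trans ti tu).
rewrite det_trig.
  by rewrite big1 // => t _; rewrite mxE N0 // addr0 mxE eqxx.
apply/is_trig_mxP => t u tu; rewrite mxE N0 ?(ltnW tu) // addr0 mxE.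
by rewrite -val_eqE /= (ltn_eqF tu).
Qed.

Lemma cols_chart_section A : chart_det A != 0 ->
  cols i (chart_section A) = A *m invmx (chart_top A).
Proof.
move=> D0; rewrite /chart_section chart_numE // /cols.
set T := chart_top A; set B := invmx g1 *m A.
have uT : T \in unitmx by rewrite unitmxE unitfE.
have E1 : copid_mx i *m B *m invmx T *m (pid_mx i : 'M_(i, n.+1)) *m
    (pid_mx i : frame) = copid_mx i *m B *m invmx T.
  by rewrite -[LHS]mulmxA mul_pid_mx minnn (minn_idPr _) ?leqW // pid_mx_1 mulmx1.
rewrite mulmxDl -(mulmxA g1) E1 -mulmxDr.
have -> : pid_mx i = (pid_mx i : 'M_n.+1) *m B *m invmx T.
  have -> : pid_mx i *m B = (pid_mx i : 'M_(n.+1, i)) *m T.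
    by rewrite /T /chart_top -/B [RHS]mulmxA mul_pid_mx minnn (minn_idPr _) ?leqW.
  by rewrite mulmxK.
rewrite -mulmxDl -mulmxDl /copid_mx addrC subrK mul1mx.
by rewrite /B !mulmxA mulmxV // mul1mx.
Qed.

Lemma chart_section_mul A h : h \in unitmx -> chart_det A != 0 ->
  chart_section (A *m h) = chart_section A.
Proof.
move=> uh D0; have D1 : chart_det (A *m h) != 0.
  by rewrite /chart_det chart_topM det_mulmx mulf_neq0 // -unitfE -unitmxE.
rewrite /chart_section !chart_numE // chart_topM.
have uT : chart_top A \in unitmx by rewrite unitmxE unitfE.
congr (g1 + g1 *m (_ *m pid_mx i)).
suff E : h *m invmx (chart_top A *m h) = invmx (chart_top A).
  by rewrite !mulmxA -(mulmxA _ h) E.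
have uTh : chart_top A *m h \in unitmx by rewrite unitmx_mul uT.
by rewrite -[LHS](mulKmx uT) [X in _ *m X]mulmxA mulmxV // mulmx1.
Qed.

(** The chart coordinates are quotients by det T, so a polynomial in the entries
    of the section becomes a polynomial in A after multiplication by a large
    power of det T.  One extra factor makes the result vanish where the section
    is not defined. *)
Lemma chart_homogenize (f : mpoly.mpoly (n.+1 * n.+1) C) :
  exists r, form r.+1 (fun A =>
    chart_det A ^+ r.+1 * mpoly.meval (fun k => mxvec (chart_section A) 0 k) f).
Proof.
pose K (F : frame -> C) := exists r, polyfun (fun A => chart_det A ^+ r * F A).
have [r Hr] : K (fun A => mpoly.meval (fun k => mxvec (chart_section A) 0 k) f).
  apply: meval_closed.
  - by move=> c; exists 0%N; apply: (polyfun_ext _ (polyfun_const c)) => A; rewrite mul1r.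
  - move=> P Q [r Hr] [q Hq]; exists (r + q)%N.
    have HD e := polyfun_exp e polyfun_chart_det.
    apply: (polyfun_ext _ (polyfun_add (polyfun_mul (HD q) Hr) (polyfun_mul (HD r) Hq))).
    by move=> A; rewrite exprD; ring.
  - move=> P Q [r Hr] [q Hq]; exists (r + q)%N.
    apply: (polyfun_ext _ (polyfun_mul Hr Hq)) => A.
    by rewrite exprD mulrACA.
  (* With D^-1 = 0 at D = 0, only the square of D clears the denominator of an
     entry at every point. *)
  - move=> k; case/mxvec_indexP: k => t u; exists 2.
    have HD e := polyfun_exp e polyfun_chart_det.
    apply: (polyfun_ext _ (polyfun_add (polyfun_mul (HD 2) (polyfun_const (g1 t u)))
      (polyfun_mul polyfun_chart_det (polyfun_chart_num t u)))) => A.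
    rewrite mxvecE !mxE mulrDr; congr (_ + _).
    have [->|D0] := eqVneq (chart_det A) 0; first by rewrite expr0n !mul0r.
    by rewrite expr2 mulrA mulfK.
exists r; split.
  apply: (polyfun_ext _ (polyfun_mul polyfun_chart_det Hr)) => A.
  by rewrite exprS mulrA.
move=> A h uh; apply: homogeneous_rescale => [|D0].
  by rewrite /chart_det chart_topM det_mulmx.
by rewrite chart_section_mul.
Qed.

End Chart.

Definition vanish_on (Y : set (cspace C n)) (P : frame -> C) :=
  forall A, isframe A -> Y (span_of A) -> P A = 0.

(** Points of SL mapping to a closed set are the zeros of polynomials that need
    not be invariant in any sense; restricting one of them to the section of a
    chart at the given point and homogenizing gives a form. *)
Lemma closed_separation Y A : zclosed i Y -> isframe A -> ~ Y (span_of A) ->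
  exists r P, [/\ form r P, vanish_on Y P & P A <> 0].
Proof.
move=> [YG [S YS]] fA nYA.
have [g Sg Ag] := Gr_SL le_in (dim_span_of fA : Gr i (span_of A)).
have ug := SL_unit Sg.
have nS : ~ mx_zero_locus S g.
  move=> zg; have : ([set g | SL g /\ Y (Defs.act g (base_point C n i))])%classic g.
    by rewrite YS.
  by case=> _; rewrite act_base // -Ag.
have [f [Sf f0]] : exists f, S f /\ mpoly.meval (fun k => mxvec g 0 k) f <> 0.
  apply: contrapT => H; apply: nS => f Sf; apply: contrapT => f0.
  by apply: H; exists f.
have [r Hr] := chart_homogenize g f.
exists r.+1, (fun A => chart_det g A ^+ r.+1 *
  mpoly.meval (fun k => mxvec (chart_section g A) 0 k) f).
split=> // [B fB YB|].
  have [->|D0] := eqVneq (chart_det g B) 0; first by rewrite expr0n mul0r.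
  have uT : chart_top g B \in unitmx by rewrite unitmxE unitfE.
  suff -> : mpoly.meval (fun k => mxvec (chart_section g B) 0 k) f = 0 by rewrite mulr0.
  have : (@SL C n `&` mx_zero_locus S)%classic (chart_section g B); last by case=> _; apply.
  rewrite -YS; split; first exact: chart_section_SL.
  by rewrite act_base // cols_chart_section // span_of_unit // unitmx_inv.
have [h uh Ah] := span_of_eq fA Ag.
have -> : chart_det g A = \det h.
  rewrite /chart_det /chart_top Ah mulmxA /cols !mulmxA -(mulmxA _ _ g) mulVmx // mulmx1.
  by rewrite mul_pid_mx minnn (minn_idPr _) ?leqW // pid_mx_1 mul1mx.
have dh0 : \det h != 0 by rewrite -unitfE -unitmxE.
apply/eqP; rewrite mulf_neq0 ?expf_neq0 //; apply/eqP.
suff -> : chart_section g A = g by [].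
have D0 : chart_det g (cols i g) != 0.
  rewrite /chart_det /chart_top /cols !mulmxA -(mulmxA _ _ g) mulVmx // mulmx1.
  by rewrite mul_pid_mx minnn (minn_idPr _) ?leqW // pid_mx_1 det1 oner_neq0.
rewrite Ah chart_section_mul // /chart_section /chart_num /cols !mulmxA.
rewrite -(mulmxA (_ *m copid_mx i) _ g) mulVmx // mulmx1 -(mulmxA _ (copid_mx i)).
have -> : copid_mx i *m (pid_mx i : 'M[C]_(n.+1, i)) = 0.
  by rewrite mulmxBl mul1mx mul_pid_mx minnn (minn_idPr _) ?leqW // subrr.
by rewrite mulmx0 !mul0mx scaler0 addr0.
Qed.

Definition zeros (P : frame -> C) : set (cspace C n) :=
  [set U | Gr i U /\ forall A, isframe A -> span_of A = U -> P A = 0]%classic.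

Lemma form_zero r (P : frame -> C) A B : form r P -> isframe A -> span_of A = span_of B ->
  P B = 0 -> P A = 0.
Proof. by move=> [_ HP] fA /(span_of_eq fA)[h uh ->] B0; rewrite HP // B0 mulr0. Qed.

Lemma zerosE r (P : frame -> C) A : form r P -> isframe A -> zeros P (span_of A) <-> P A = 0.
Proof.
move=> HP fA; split=> [[_]|A0]; first exact.
split; first exact: dim_span_of.
by move=> B fB BA; apply: form_zero HP fB BA A0.
Qed.

Lemma zclosed_zeros r (P : frame -> C) : form r P -> zclosed i (zeros P).
Proof.
move=> HP; split; first by move=> U [].
have [f Hf] := polyfun_mpoly le_in (proj1 HP).
exists [set f]%classic; apply/seteqP; split=> [g [Sg]|g [Sg zg]].
  rewrite act_base // (zerosE HP) => [P0|]; last exact/isframe_cols/SL_unit.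
  by split=> // _ ->; rewrite Hf.
split=> //; rewrite act_base //; apply/(zerosE HP); first exact/isframe_cols/SL_unit.
by rewrite -Hf; apply: zg.
Qed.

Lemma Gr_frame U : Gr i U -> exists2 A : frame, isframe A & U = span_of A.
Proof.
move=> /(Gr_SL le_in)[g Sg ->]; exists (cols i g) => //.
exact/isframe_cols/SL_unit.
Qed.

Definition frames_of (Y : set (cspace C n)) : set frame :=
  [set A | isframe A /\ Y (span_of A)]%classic.

(** The consequence of irreducibility that matters for forms, on a set of
    matrices rather than of subspaces so that it also makes sense for coordinate
    subspaces of a cell. *)
Definition integral_set (Y : set frame) :=
  forall r1 r2 P Q, form r1 P -> form r2 Q -> (forall A, Y A -> P A * Q A = 0) ->
  (forall A, Y A -> P A = 0) \/ (forall A, Y A -> Q A = 0).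

Lemma zirreducible_integral Y : (Y `<=` Gr i)%classic -> zirreducible i Y ->
  integral_set (frames_of Y).
Proof.
move=> YG [_ irrY] r1 r2 P Q HP HQ PQ0.
have [|YP|YQ] := irrY _ _ (zclosed_zeros HP) (zclosed_zeros HQ).
- move=> U YU; have [A fA UA] := Gr_frame (YG _ YU).
  have /eqP := PQ0 A (conj fA (eq_ind _ Y YU _ UA)).
  rewrite mulf_eq0 UA => /orP[]/eqP Z; [left|right].
    by apply/(zerosE HP).
  by apply/(zerosE HQ).
- by left=> A [fA /YP]; rewrite (zerosE HP).
- by right=> A [fA /YQ]; rewrite (zerosE HQ).
Qed.

Lemma zclosure_closed (Y : set (cspace C n)) : zclosed i (zclosure i Y).
Proof.
split; first by move=> U [].
pose S := [set f : mpoly.mpoly (n.+1 * n.+1) C | forall g, SL g ->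
  zclosure i Y (Defs.act g (base_point C n i)) -> mpoly.meval (fun k => mxvec g 0 k) f = 0]%classic.
exists S; apply/seteqP; split=> [g [Sg Yg]|g [Sg zg]].
  by split=> // f; apply.
split=> //; split.
  by rewrite act_base //; apply: dim_span_of; apply/isframe_cols/SL_unit.
move=> Y' [Y'G [S' Y'S]] YY'.
suff : ([set g | SL g /\ Y' (Defs.act g (base_point C n i))])%classic g by case.
rewrite Y'S; split=> // f S'f; apply: zg => g' Sg' [_ /(_ Y')].
move=> /(_ (conj Y'G (ex_intro _ S' Y'S)) YY') Y'g'.
have : (@SL C n `&` mx_zero_locus S')%classic g' by rewrite -Y'S.
by case=> _; apply.
Qed.

Lemma zclosure_sub (Y : set (cspace C n)) : (Y `<=` Gr i)%classic ->
  (Y `<=` zclosure i Y)%classic.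
Proof. by move=> YG U YU; split; [apply: YG|move=> Y' _; apply]. Qed.

Lemma zclosure_min (Y Y' : set (cspace C n)) : zclosed i Y' -> (Y `<=` Y')%classic ->
  (zclosure i Y `<=` Y')%classic.
Proof. by move=> cY' YY' U [_]; apply. Qed.

Lemma zclosure_vanish (Y : set (cspace C n)) r (P : frame -> C) : (Y `<=` Gr i)%classic ->
  form r P -> vanish_on Y P -> vanish_on (zclosure i Y) P.
Proof.
move=> YG HP YP A fA; rewrite -(zerosE HP fA).
apply: (zclosure_min (zclosed_zeros HP)) => U YU.
have [B fB UB] := Gr_frame (YG _ YU).
by rewrite UB (zerosE HP) //; apply: YP => //; rewrite -UB.
Qed.

(** Only products of forms have to be tested, because two closed sets not
    containing Y are separated from points of Y by forms. *)
Lemma zirreducible_closure (Y : set (cspace C n)) : (Y `<=` Gr i)%classic ->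
  Y !=set0%classic -> integral_set (frames_of Y) -> zirreducible i (zclosure i Y).
Proof.
move=> YG [U YU] intY; split; first by exists U; apply: zclosure_sub.
move=> Y1 Y2 c1 c2 Y12; apply: contrapT => /not_orP[n1 n2].
have sep Y0 : zclosed i Y0 -> ~ (zclosure i Y `<=` Y0)%classic ->
    exists r P, [/\ form r P, vanish_on Y0 P & exists2 A, frames_of Y A & P A <> 0].
  move=> c0 n0.
  have [V [YV nV]] : exists V, Y V /\ ~ Y0 V.
    apply: contrapT => H; apply: n0; apply: zclosure_min => // V YV.
    by apply: contrapT => nV; apply: H; exists V.
  have [A fA VA] := Gr_frame (YG _ YV); subst V.
  have [r [P [HP vP PA]]] := closed_separation c0 fA nV.
  by exists r, P; split=> //; exists A.
have [r1 [P1 [HP1 v1 [A1 YA1 PA1]]]] := sep _ c1 n1.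
have [r2 [P2 [HP2 v2 [A2 YA2 PA2]]]] := sep _ c2 n2.
have [|Z|Z] := intY _ _ _ _ HP1 HP2.
- move=> A [fA YA]; have [Z|Z] := Y12 _ (zclosure_sub YG YA).
    by rewrite v1 // mul0r.
  by rewrite v2 // mulr0.
- by apply: PA1; apply: Z.
- by apply: PA2; apply: Z.
Qed.

End ClosedSets.

(** * Schubert cells *)

Section Cells.
Variables (C : numFieldType) (n i : nat).
Hypothesis le_in : (i <= n)%N.
Local Notation frame := 'M[C]_(n.+1, i).

Lemma poly_eq0 (p : {poly C}) m : (size p <= m)%N ->
  (forall e, (e < m)%N -> p.[e%:R] = 0) -> p = 0.
Proof.
move=> sp p0; apply: (@roots_geq_poly_eq0 _ _ [seq e%:R | e <- iota 0 m]).
- by apply/allP => x /mapP[e]; rewrite mem_iota => /= /p0 e0 ->; apply/rootP.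
- by rewrite map_inj_uniq ?iota_uniq // => a b /eqP; rewrite eqr_nat => /eqP.
- by rewrite size_map size_iota.
Qed.

Lemma poly_eq0_inf (p : {poly C}) (bad : C) : (forall t, t != bad -> p.[t] = 0) -> p = 0.
Proof.
move=> p0; suff /eqP : p * ('X - bad%:P) = 0.
  by rewrite mulf_eq0 polyXsubC_eq0 orbF => /eqP.
apply: (poly_eq0 (leqnn _)) => e _; rewrite hornerM hornerXsubC.
have [->|eb] := eqVneq e%:R bad; first by rewrite subrr mulr0.
by rewrite p0 ?mul0r.
Qed.

(** On the line through a point where P is not zero and a point where Q is not
    zero, P and Q are nonzero polynomials in one variable, and the field is
    infinite. *)
Lemma integral_affine (Y : set frame) :
  (forall A B t, Y A -> Y B -> Y (A + t *: (B - A))) -> integral_set Y.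
Proof.
move=> affY r1 r2 P Q [pP _] [pQ _] PQ0; apply: contrapT => /not_orP[nP nQ].
have ex F : ~ (forall A, Y A -> F A = 0 :> C) -> exists2 A, Y A & F A <> 0.
  move=> nF; apply: contrapT => H; apply: nF => A YA; apply: contrapT => FA.
  by apply: H; exists A.
have [A YA PA] := ex _ nP; have [B YB QB] := ex _ nQ.
have [p Hp] := polyfun_line A (B - A) pP.
have [q Hq] := polyfun_line A (B - A) pQ.
have : p * q = 0.
  apply: (@poly_eq0_inf _ 0) => t _; rewrite hornerM Hp Hq; apply: PQ0; exact: affY.
move=> /eqP; rewrite mulf_eq0 => /orP[]/eqP Z.
  by apply: PA; rewrite -[A]addr0 -(scale0r (B - A)) -Hp Z horner0.
by apply: QB; rewrite -[B](subrK A) addrC -(scale1r (B - A)) -Hq Z horner0.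
Qed.

Definition increasing (s : 'I_i -> 'I_n.+1) := forall a b : 'I_i, (a < b)%N -> (s a < s b)%N.

Definition echelon (s : 'I_i -> 'I_n.+1) (A : frame) :=
  (forall (t : 'I_n.+1) k, (s k < t)%N -> A t k = 0) /\ (forall k, A (s k) k != 0).

Definition cell s : set (cspace C n) :=
  [set U | exists2 A, echelon s A & U = span_of A]%classic.

(** The entries of a reduced echelon matrix of shape s that are not forced to be
    0 or 1.  They correspond to the inversions of the minimal
    representative w with w^-1(k) = s k. *)
Definition free_entry (s : 'I_i -> 'I_n.+1) : pred ('I_n.+1 * 'I_i) :=
  fun x => (x.1 < s x.2)%N && (x.1 \notin codom s).

Local Notation index s := {x | free_entry s x}.

(** The reduced echelon matrix with the given free entries. *)
Definition cell_frame s (y : index s -> C) : frame :=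
  \matrix_(t, k) ((t == s k)%:R + oapp y 0 (insub (t, k))).

Lemma isframe_rowsub (s : 'I_i -> 'I_n.+1) (A : frame) : rowsub s A \in unitmx -> isframe A.
Proof.
move=> uA; exists (invmx (rowsub s A) *m rowsub s 1%:M).
by rewrite -mulmxA mul_rowsub_mx mul1mx mulVmx.
Qed.

Section Shape.
Variable s : 'I_i -> 'I_n.+1.
Hypothesis inc : increasing s.

Lemma increasing_leq (a b : 'I_i) : (a <= b)%N -> (s a <= s b)%N.
Proof.
by rewrite leq_eqVlt => /orP[/eqP/val_inj->//|/inc/ltnW].
Qed.

Lemma increasing_inj : injective s.
Proof.
move=> a b E; apply: val_inj; case: (ltngtP a b) => // /inc.
  by rewrite E ltnn.
by rewrite E ltnn.
Qed.

Lemma det_triangular (T : 'M[C]_i) : (forall l k : 'I_i, (k < l)%N -> T l k = 0) ->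
  \det T = \prod_k T k k.
Proof.
move=> T0; rewrite -det_tr det_trig; first by apply: eq_bigr => k _; rewrite mxE.
by apply/is_trig_mxP => a b ab; rewrite mxE T0.
Qed.

Lemma echelon_minor (A : frame) : echelon s A -> rowsub s A \in unitmx.
Proof.
move=> [A0 A1]; rewrite unitmxE unitfE det_triangular.
  by apply/prodf_neq0 => k _; rewrite mxE.
by move=> l k lk; rewrite mxE; apply: A0; apply: inc.
Qed.

Lemma echelon_isframe (A : frame) : echelon s A -> isframe A.
Proof. by move=> /echelon_minor; apply: isframe_rowsub. Qed.

Lemma cell_Gr : (cell s `<=` Gr i)%classic.
Proof. by move=> U [A /echelon_isframe fA ->]; apply: dim_span_of. Qed.

Lemma upper_inverse (T : 'M[C]_i) : (forall l k : 'I_i, (k < l)%N -> T l k = 0) ->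
  (forall k, T k k != 0) -> forall l k : 'I_i, (k < l)%N -> invmx T l k = 0.
Proof.
move=> T0 T1; have uT : T \in unitmx.
  by rewrite unitmxE unitfE det_triangular //; apply/prodf_neq0.
move=> l k; have [m] := ubnP (i - l)%N; elim: m l => // m IH l lm kl.
have /matrixP/(_ l k) := mulmxV uT; rewrite !mxE (bigD1 l) //= big1.
  rewrite -val_eqE /= (gtn_eqF kl) addr0 => /eqP; rewrite mulf_eq0 (negPf (T1 l)) /=.
  by move/eqP.
move=> l' nl; case: (ltnP l' l) => [/T0 ->|ll']; first by rewrite mul0r.
have {}ll' : (l < l')%N by rewrite ltn_neqAle ll' andbT eq_sym.
rewrite IH ?mulr0 //; last exact: ltn_trans ll'.
by have := ltn_ord l'; move: lm ll'; clear; lia.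
Qed.

Lemma cell_frame_minor (y : index s -> C) : rowsub s (cell_frame y) = 1%:M.
Proof.
apply/matrixP => l k; rewrite !mxE (inj_eq increasing_inj) insubF ?addr0 //.
by rewrite /free_entry /= codom_f andbF.
Qed.

Lemma cell_frame_isframe (y : index s -> C) : isframe (cell_frame y).
Proof. by apply: (@isframe_rowsub s); rewrite cell_frame_minor unitmx1. Qed.

Lemma cell_frame_echelon (y : index s -> C) : echelon s (cell_frame y).
Proof.
split=> [t k st|k].
  rewrite mxE insubF; last by rewrite /free_entry /= ltnNge (ltnW st).
  by rewrite -val_eqE /= (gtn_eqF st) addr0.
have /matrixP/(_ k k) := cell_frame_minor y.
by rewrite mxE [RHS]mxE eqxx => ->; rewrite oner_neq0.
Qed.

(** Column reduction.  Multiplying by the inverse of the minor on the rows s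
    creates the identity there, and does not spoil the zeros below the leading
    entries because this inverse is upper triangular. *)
Lemma echelon_reduce (A : frame) : echelon s A ->
  exists2 h, h \in unitmx & exists y, A *m h = cell_frame (s := s) y.
Proof.
move=> eA; have uT := echelon_minor eA; have [A0 A1] := eA.
set T := rowsub s A in uT.
exists (invmx T); first by rewrite unitmx_inv.
set A' := A *m invmx T.
have A'0 (t : 'I_n.+1) k : (s k < t)%N -> A' t k = 0.
  move=> st; rewrite mxE big1 // => l _; case: (leqP l k) => lk.
    by rewrite A0 ?mul0r // (leq_ltn_trans _ st) // increasing_leq.
  rewrite upper_inverse ?mulr0 // => [a b ab|a]; rewrite mxE //.
  by apply: A0; apply: inc.
have A'1 : rowsub s A' = 1%:M by rewrite /A' -mul_rowsub_mx mulmxV.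
exists (fun x => A' (val x).1 (val x).2); apply/matrixP => t k; rewrite [RHS]mxE.
case: (boolP (free_entry s (t, k))) => [fx|nf].
  rewrite insubT /=; move: fx; rewrite /free_entry /= => /andP[ts tn].
  case: eqP => [E|_]; last by rewrite add0r.
  by rewrite E codom_f in tn.
rewrite insubF ?(negPf nf) // addr0; case: (boolP (t \in codom s)) => [/codomP[l ->]|tn].
  have /matrixP/(_ l k) := A'1; rewrite mxE => ->.
  by rewrite mxE (inj_eq increasing_inj).
have /negPf -> : t != s k by apply: contraNneq tn => ->; apply: codom_f.
apply: A'0; rewrite ltn_neqAle; apply/andP; split.
  by apply: contraNneq tn => E; apply/codomP; exists k; apply: val_inj.
by rewrite /free_entry /= tn andbT -leqNgt in nf.
Qed.

Lemma cellP U : cell s U <-> exists y, U = span_of (cell_frame (s := s) y).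
Proof.
split=> [[A /echelon_reduce[h uh [y Ay]] ->]|[y ->]].
  by exists y; rewrite -Ay span_of_unit.
by exists (cell_frame y) => //; apply: cell_frame_echelon.
Qed.

Lemma cell_frame_vanish r (P : frame -> C) : form r P ->
  (forall y, P (cell_frame (s := s) y) = 0) -> vanish_on (cell s) P.
Proof.
by move=> HP P0 A fA /cellP[y Ay]; apply: form_zero HP fA Ay (P0 y).
Qed.

Lemma cell_frame_affine (y z : index s -> C) t :
  cell_frame y + t *: (cell_frame z - cell_frame y) =
  cell_frame (fun x => y x + t * (z x - y x)).
Proof.
apply/matrixP => u k; rewrite !mxE; case: (insub _) => [x|] /=; ring.
Qed.

(** Coordinate subspaces of the cell, used to grow independent families inside
    one cell in the same way as along a chain of varieties. *)
Definition coord_frames (D : pred (index s)) : set frame :=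
  [set A | exists2 y : index s -> C, (forall x, ~~ D x -> y x = 0) & A = cell_frame y]%classic.

Lemma coord_frames_integral D : integral_set (coord_frames D).
Proof.
apply: integral_affine => A B t [y y0 ->] [z z0 ->].
exists (fun x => y x + t * (z x - y x)); last exact: cell_frame_affine.
by move=> x nx; rewrite y0 // z0 // subrr mulr0 addr0.
Qed.

Lemma cell_integral : @integral_set C n i (frames_of (cell s)).
Proof.
move=> r1 r2 P Q HP HQ PQ0.
have [|Z|Z] := @coord_frames_integral predT _ _ _ _ HP HQ.
- move=> A [y _ ->]; apply: PQ0; split; first exact: cell_frame_isframe.
  by apply/cellP; exists y.
- left=> A [fA]; apply: (cell_frame_vanish HP) => // y; apply: Z; by exists y.
- right=> A [fA]; apply: (cell_frame_vanish HQ) => // y; apply: Z; by exists y.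
Qed.

Lemma cell_nonempty : (cell s !=set0)%classic.
Proof. by exists (span_of (cell_frame (s := s) (fun=> 0))); apply/cellP; exists (fun=> 0). Qed.

(** For the inclusion from right to left, a reduced echelon matrix is carried to
    its place by the upper unitriangular matrix that has its columns at the
    positions s and the standard basis elsewhere. *)
Lemma borel_cell : [set U | exists2 b, borel b &
  U = Defs.act b (span_of (\matrix_(t, k) (t == s k)%:R : frame))]%classic = cell s.
Proof.
set E : frame := \matrix_(t, k) (t == s k)%:R.
have bE (b : 'M[C]_n.+1) t k : (b *m E) t k = b t (s k).
  rewrite mxE (bigD1 (s k)) //= big1 => [|u us]; first by rewrite mxE eqxx mulr1 addr0.
  by rewrite mxE (negPf us) mulr0.
apply/seteqP; split=> [U [b [Sb b0] ->]|U /cellP[y ->]].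
  exists (b *m E); last by rewrite act_span.
  split=> [t k st|k]; first by rewrite bE b0.
  rewrite bE; have : \det b != 0 by rewrite Sb oner_neq0.
  rewrite -det_tr det_trig => [/prodf_neq0/(_ (s k) isT)|]; first by rewrite mxE.
  by apply/is_trig_mxP => u v uv; rewrite mxE b0.
pose b : 'M[C]_n.+1 := 1 + (cell_frame y - E) *m E^T.
have bN (t u : 'I_n.+1) : (u <= t)%N -> ((cell_frame y - E) *m E^T) t u = 0.
  move=> ut; rewrite mxE big1 // => k _; rewrite [E^T _ _]mxE [E _ _]mxE.
  case: eqP => [us|_]; last by rewrite mulr0.
  rewrite mulr1 !mxE insubF ?addr0 ?subrr //.
  by rewrite /free_entry /= ltnNge -us ut.
exists b; first split.
- rewrite /SL /= -det_tr det_trig; last first.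
    apply/is_trig_mxP => u v uv; rewrite mxE mxE bN ?(ltnW uv) // addr0 mxE.
    by rewrite -val_eqE /= (gtn_eqF uv).
  by rewrite big1 // => t _; rewrite mxE mxE bN // addr0 mxE eqxx.
- by move=> t u ut; rewrite mxE bN ?(ltnW ut) // addr0 mxE -val_eqE /= (gtn_eqF ut).
rewrite act_span; congr span_of.
have EE : E^T *m E = 1%:M.
  apply/matrixP => a c; rewrite mxE (bigD1 (s c)) //= big1 => [|u us].
    by rewrite !mxE eqxx mulr1 addr0 (inj_eq increasing_inj) eq_sym.
  by rewrite !mxE (negPf us) mulr0.
by rewrite mulmxDl mul1mx -mulmxA EE mulmx1 addrC subrK.
Qed.

End Shape.

Definition shape_variety s : set (cspace C n) := zclosure i (cell s).

Lemma shape_variety_closed s : zclosed i (shape_variety s).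
Proof. exact: zclosure_closed. Qed.

Lemma shape_variety_irreducible s : increasing s -> zirreducible i (shape_variety s).
Proof.
move=> inc; apply: zirreducible_closure => //.
- exact: cell_Gr.
- exact: cell_nonempty.
- exact: cell_integral.
Qed.

Section Step.
Variables (s s' : 'I_i -> 'I_n.+1) (k0 : 'I_i).
Hypotheses (inc : increasing s) (inc' : increasing s').
Hypotheses (s'k0 : s' k0 = (s k0).+1 :> nat) (s'k : forall k, k != k0 -> s' k = s k).

Lemma step_leq k : (s k <= s' k)%N.
Proof. by have [->|/s'k ->//] := eqVneq k k0; rewrite s'k0. Qed.

(** Adding t in the row below the leading entry of column k0 turns an echelon
    matrix of shape s into one of shape s' for all t <> 0, so a form vanishing
    on the cell of s' also vanishes at t = 0. *)
Lemma shape_step_sub : (shape_variety s `<=` shape_variety s')%classic.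
Proof.
apply: zclosure_min; first exact: shape_variety_closed.
move=> U [A eA ->]; apply: contrapT => nA.
have fA := echelon_isframe inc eA.
have [r [P [HP vP PA]]] := closed_separation le_in (shape_variety_closed s') fA nA.
pose B : frame := delta_mx (s' k0) k0.
have [p Hp] := polyfun_line A B (proj1 HP).
have p0 : p = 0.
  apply: (@poly_eq0_inf _ 0) => t t0; rewrite Hp.
  have eAt : echelon s' (A + t *: B).
    have [A0 A1] := eA; split=> [u k su|k].
      rewrite !mxE A0; last exact: leq_ltn_trans (step_leq k) su.
      case: eqP => [E|_] /=; last by rewrite mulr0 addr0.
      case: eqP => [E'|_] /=; last by rewrite mulr0 addr0.
      by rewrite E E' ltnn in su.
    rewrite !mxE; have [->|kk] := eqVneq k k0.
      by rewrite A0 ?s'k0 // eqxx mulr1 add0r.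
    by rewrite andbF mulr0 addr0 s'k.
  apply: vP; first exact: echelon_isframe eAt.
  apply: zclosure_sub; first exact: cell_Gr.
  by exists (A + t *: B).
by apply: PA; rewrite -[A]addr0 -(scale0r B) -Hp p0 horner0.
Qed.

(** The minor on the rows s' is 1 on reduced matrices of shape s', and is
    triangular with a zero on the diagonal, at k0, on those of shape s. *)
Lemma shape_step_proper : (shape_variety s `<` shape_variety s')%classic.
Proof.
split; first exact: shape_step_sub.
move=> sub; have HD := form_minor C s'.
have vD : vanish_on (shape_variety s) (fun A => \det (rowsub s' A)).
  apply: (zclosure_vanish le_in (cell_Gr inc) HD) => A fA [B [B0 B1] AB].
  apply: (form_zero HD fA AB); rewrite det_triangular.
    by rewrite (bigD1 k0) //= mxE B0 ?mul0r // s'k0.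
  move=> l k kl; rewrite mxE B0 //; exact: leq_trans (inc kl) (step_leq l).
have := vD (cell_frame (s := s') (fun=> 0)).
rewrite cell_frame_minor // det1 => H.
have /eqP := oner_neq0 C; apply; apply: H; first exact: cell_frame_isframe.
apply: sub; apply: zclosure_sub; first exact: cell_Gr.
by apply/cellP => //; exists (fun=> 0).
Qed.

End Step.

End Cells.

(** * Growth of independent families of forms *)

Section Growth.
Variables (C : numFieldType) (n i : nat).
Local Notation frame := 'M[C]_(n.+1, i).

Section DegreeInEachVariable.
Variable T : finType.

Definition update (y : T -> C) x t : T -> C := fun x' => if x' == x then t else y x'.

(** Degree at most e in each variable separately, expressed through the
    restrictions to coordinate lines; this avoids polynomials in several
    variables, and suffices for interpolation on a grid. *)
Definition degree_le (e : nat) (f : (T -> C) -> C) :=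
  forall y x, exists2 p : {poly C}, (size p <= e.+1)%N & forall t, f (update y x t) = p.[t].

Lemma degree_le_const e c : degree_le e (fun=> c).
Proof.
move=> y x; exists c%:P; last by move=> t; rewrite hornerC.
by rewrite size_polyC; case: (c != 0).
Qed.

Lemma degree_le_add e f g : degree_le e f -> degree_le e g -> degree_le e (fun y => f y + g y).
Proof.
move=> df dg y x; have [p sp fp] := df y x; have [q sq gq] := dg y x.
exists (p + q); first by rewrite (leq_trans (size_polyD _ _)) // geq_max sp.
by move=> t; rewrite fp gq hornerD.
Qed.

Lemma degree_le_mul e e' f g : degree_le e f -> degree_le e' g ->
  degree_le (e + e') (fun y => f y * g y).
Proof.
move=> df dg y x; have [p sp fp] := df y x; have [q sq gq] := dg y x.
exists (p * q); last by move=> t; rewrite fp gq hornerM.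
by rewrite (leq_trans (size_polyMleq _ _)) //; lia.
Qed.

Lemma degree_le_leq e e' f : (e <= e')%N -> degree_le e f -> degree_le e' f.
Proof.
by move=> ee df y x; have [p sp fp] := df y x; exists p => //; apply: leq_trans sp _.
Qed.

Lemma degree_le_exp e m f : degree_le e f -> degree_le (e * m) (fun y => f y ^+ m).
Proof.
move=> df; elim: m => [|m IH]; first exact: degree_le_const.
have := degree_le_mul df IH; rewrite mulnS; congr degree_le.
by apply/funext => y; rewrite exprS.
Qed.

Lemma degree_le_sum (I : Type) (r : seq I) (D : pred I) e F :
  (forall x, degree_le e (F x)) -> degree_le e (fun y => \sum_(x <- r | D x) F x y).
Proof.
move=> dF; elim: r => [|x r IH].
  have := degree_le_const e 0; congr degree_le; apply/funext => y; by rewrite big_nil.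
case: (boolP (D x)) => Dx.
  have := degree_le_add (dF x) IH; congr degree_le; apply/funext => y; by rewrite big_cons Dx.
by move: IH; congr degree_le; apply/funext => y; rewrite big_cons (negPf Dx).
Qed.

(** Such a function vanishes once it vanishes on {0,...,e}^T: the variables are
    freed one at a time. *)
Lemma degree_le_grid e f : degree_le e f ->
  (forall g : {ffun T -> 'I_e.+1}, f (fun x => (g x)%:R) = 0) -> forall y, f y = 0.
Proof.
move=> df f0.
suff H (r : seq T) y : (forall x, x \notin r -> exists c : 'I_e.+1, y x = c%:R) -> f y = 0.
  by move=> y; apply: (H (enum T)) => x; rewrite mem_enum.
elim: r y => [|x r IH] y Hy.
  have /fin_all_exists[g Hg] x : exists c : 'I_e.+1, y x = c%:R by apply: Hy.
  rewrite -(f0 [ffun x => g x]); congr f; apply/funext => x; by rewrite ffunE.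
have [p sp fp] := df y x.
have p0 : p = 0.
  apply: (poly_eq0 sp) => c ce; rewrite -fp; apply: IH => x' x'r; rewrite /update.
  have [_|xx] := eqVneq x' x; first by exists (Ordinal ce).
  by apply: Hy; rewrite inE negb_or xx.
have -> : y = update y x (y x).
  by apply/funext => x'; rewrite /update; case: eqP => [->|].
by rewrite fp p0 horner0.
Qed.

End DegreeInEachVariable.

Definition independent (Y : set frame) (I : finType) (b : I -> frame -> C) :=
  forall c : I -> C, (forall A, Y A -> \sum_x c x * b x A = 0) -> forall x, c x = 0.

(** By induction on j, the coefficients of P^j vanish: what remains of a relation
    is P^j times a form G, so G vanishes on Y' by integrality, and on Y, where
    P = 0, it reduces to its terms of exponent j. *)
Lemma independent_step (Y Y' : set frame) (I : finType) (b : I -> frame -> C) W r d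
    (P Q : frame -> C) :
  integral_set Y -> integral_set Y' -> (Y `<=` Y')%classic ->
  (forall x, form W (b x)) -> form r P -> form r Q ->
  (forall A, Y A -> P A = 0) ->
  (exists2 A, Y' A & P A <> 0) -> (exists2 A, Y A & Q A <> 0) ->
  independent Y b ->
  independent Y' (fun (z : I * 'I_d.+1) A => b z.1 A * (P A ^+ z.2 * Q A ^+ (d - z.2))).
Proof.
move=> intY intY' YY' Hb HP HQ P0 [AP YAP PAP] [AQ YAQ QAQ] indb c Hc.
suff H (m : nat) (j : 'I_d.+1) : (j < m)%N -> forall x, c (x, j) = 0.
  by case=> x j; apply: (H j.+1).
elim: m j => // m IH j; rewrite ltnS leq_eqVlt => /orP[/eqP jm|/IH//].
pose G A := \sum_(l : 'I_d.+1 | (j <= l)%N) \sum_x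
    c (x, l) * (b x A * (P A ^+ (l - j) * Q A ^+ (d - l))).
have HG : form (W + r * (d - j)) G.
  apply: form_sum => l jl; apply: form_sum => x _; apply: form_scale.
  apply: form_mul => //.
  have -> : (r * (d - j) = r * (l - j) + r * (d - l))%N.
    by rewrite -mulnDr; congr muln; have := ltn_ord l; lia.
  by apply: form_mul; apply: form_exp.
have PG A : Y' A -> P A ^+ j * G A = 0.
  move=> YA; rewrite -[RHS](Hc A YA) /G mulr_sumr.
  rewrite (eq_bigr (fun z => c (z.1, z.2) * (b z.1 A * (P A ^+ z.2 * Q A ^+ (d - z.2)))));
    last by case.
  rewrite -(pair_bigA _ (fun x (l : 'I_d.+1) => c (x, l) * (b x A * (P A ^+ l * Q A ^+ (d - l))))) /=.
  rewrite exchange_big /= [RHS](bigID (fun l : 'I_d.+1 => (j <= l)%N)) /=.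
  rewrite [X in _ = _ + X]big1 => [|l]; last first.
    rewrite -ltnNge jm => /IH l0; apply: big1 => x _; by rewrite l0 mul0r.
  rewrite addr0; apply: eq_bigr => l jl; rewrite mulr_sumr; apply: eq_bigr => x _.
  have -> : P A ^+ l = P A ^+ j * P A ^+ (l - j) by rewrite -exprD subnKC.
  by ring.
have [Z|G0] := intY' _ _ _ _ (form_exp j HP) HG PG.
  by have /eqP := Z _ YAP; rewrite expf_eq0 => /andP[_ /eqP].
have Hsum : form W (fun A => \sum_x c (x, j) * b x A).
  by apply: form_sum => x _; apply: form_scale.
have [A YA||Z] := intY _ _ _ _ Hsum (form_exp (d - j) HQ).
- have := G0 A (YY' _ YA); rewrite /G (bigD1 j) //= [X in _ + X]big1 => [|l].
    rewrite addr0 mulr_suml => GA; rewrite -[RHS]GA; apply: eq_bigr => x _.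
    by rewrite subnn mul1r mulrA.
  case/andP => jl lj; apply: big1 => x _; rewrite P0 // expr0n.
  have -> : (l - j == 0)%N = false.
    by apply/negbTE; rewrite subn_eq0 -ltnNge ltn_neqAle eq_sym lj.
  by rewrite mul0r mulr0 mulr0.
- by move/indb.
- by have /eqP := Z _ YAQ; rewrite expf_eq0 => /andP[_ /eqP].
Qed.

Section Parametrized.
Variables (T : finType) (phi : (T -> C) -> frame).
Hypothesis phi_degree : forall t k, degree_le 1 (fun y => phi y t k).

Lemma polyfun_degree P : polyfun P -> exists e, degree_le e (fun y => P (phi y)).
Proof.
elim=> [t k|c|{}P Q _ [p Hp] _ [q Hq]|{}P Q _ [p Hp] _ [q Hq]].
- by exists 1%N.
- by exists 0%N; apply: degree_le_const.
- exists (p + q)%N; apply: degree_le_add.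
    exact: degree_le_leq (leq_addr _ _) Hp.
  exact: degree_le_leq (leq_addl _ _) Hq.
- by exists (p + q)%N; apply: degree_le_mul.
Qed.

(** At least (d+1)^N independent forms of degree O(d) along phi: the set Y has
    dimension at least N.  Bounding each exponent by d, rather than the total
    degree, makes the number of monomials an exact power. *)
Definition growth N (Y : set frame) := exists R, forall d,
  exists (I : finType) (b : I -> frame -> C) W,
    [/\ #|I| = (d.+1 ^ N)%N, forall x, form W (b x),
        forall x, degree_le (R * d) (fun y => b x (phi y)) & independent Y b].

Lemma growth_point (Y : set frame) A : Y A -> growth 0 Y.
Proof.
move=> YA; exists 0%N => d; exists unit, (fun _ _ => 1), 0%N; split.
- by rewrite card_unit.
- by move=> _; apply: form_const.
- by move=> _; apply: degree_le_const.
- by move=> c /(_ A YA) + []; rewrite (bigD1 tt) //= big1 ?addr0 ?mulr1 // => -[].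
Qed.

Lemma growth_sub N (Y Y' : set frame) : (Y `<=` Y')%classic -> growth N Y -> growth N Y'.
Proof.
move=> YY' [R HR]; exists R => d; have [I [b [W [cI Hb db ib]]]] := HR d.
exists I, b, W; split=> // c Hc; apply: ib => A /YY'; exact: Hc.
Qed.

Lemma growth_step N (Y Y' : set frame) r P Q :
  integral_set Y -> integral_set Y' -> (Y `<=` Y')%classic ->
  form r P -> form r Q -> (forall A, Y A -> P A = 0) ->
  (exists2 A, Y' A & P A <> 0) -> (exists2 A, Y A & Q A <> 0) ->
  growth N Y -> growth N.+1 Y'.
Proof.
move=> intY intY' YY' HP HQ P0 PN QN [R HR].
have [p dP] := polyfun_degree (proj1 HP); have [q dQ] := polyfun_degree (proj1 HQ).
exists (R + (p + q))%N => d; have [I [b [W [cI Hb db ib]]]] := HR d.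
pose b' (z : I * 'I_d.+1) A := b z.1 A * (P A ^+ z.2 * Q A ^+ (d - z.2)).
exists (I * 'I_d.+1)%type, b', (W + r * d)%N.
split.
- by rewrite card_prod card_ord cI expnSr.
- case=> x j /=; apply: form_mul => //.
  have -> : (r * d = r * j + r * (d - j))%N by rewrite -mulnDr subnKC // -ltnS.
  by apply: form_mul; apply: form_exp.
- case=> x j /=; rewrite mulnDl; apply: degree_le_mul => //.
  have jd : (j <= d)%N by rewrite -ltnS.
  rewrite mulnDl; apply: degree_le_mul.
    by apply: degree_le_leq (degree_le_exp j dP); rewrite leq_mul2l jd orbT.
  by apply: degree_le_leq (degree_le_exp (d - j) dQ); rewrite leq_mul2l leq_subr orbT.
- exact: (independent_step intY intY' YY' Hb HP HQ).
Qed.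

(** If the image of phi is dense in Y for forms, its parameters bound the
    growth: a combination of the forms vanishes on the grid as soon as there are
    more forms than grid points, hence it vanishes everywhere. *)
Lemma growth_leq N (Y : set frame) :
  (forall r P, form r P -> (forall y, P (phi y) = 0) -> forall A, Y A -> P A = 0) ->
  growth N Y -> (N <= #|T|)%N.
Proof.
move=> dense [R HR]; rewrite leqNgt; apply/negP => TN.
(* The grid has (R d + 1)^|T| <= (R+1)^|T| (d+1)^|T| points, which is less than
   (d+1)^(|T|+1) for this d. *)
pose d := (R.+1 ^ #|T|)%N.
have [I [b [W [cI Hb db ib]]]] := HR d.
pose J := {ffun T -> 'I_(R * d).+1}.
have ltJI : (#|{: J}| < #|I|)%N.
  rewrite card_ffun card_ord cI.
  apply: (@leq_trans (d.+1 ^ #|T|.+1)); last by rewrite leq_exp2l // ltnS expn_gt0.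
  apply: (@leq_ltn_trans ((R.+1 * d.+1) ^ #|T|)).
    case: (posnP #|T|) => [->|T0]; first by rewrite !expn0.
    by rewrite leq_exp2r //; lia.
  rewrite expnMn expnS ltn_mul2r expn_gt0 /=; exact: leqnn.
pose M : 'M[C]_(#|I|, #|{: J}|) :=
  \matrix_(u, v) b (enum_val u) (phi (fun x => ((enum_val v : J) x)%:R)).
have nfree : ~~ row_free M.
  by rewrite /row_free neq_ltn (leq_ltn_trans (rank_leq_col M)).
have [c cM c0] : exists2 c : 'rV_#|I|, c *m M = 0 & c != 0.
  move: nfree; rewrite -kermx_eq0 => /rowV0Pn[c /sub_kermxP cM c0]; by exists c.
case/negP: c0; apply/eqP/rowP => u; rewrite mxE.
pose c' x := c 0 (enum_rank x).
suff /(_ (enum_val u)) : forall x, c' x = 0 by rewrite /c' enum_valK.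
apply: ib; apply: (dense W).
  by apply: form_sum => x _; apply: form_scale.
apply: (@degree_le_grid _ (R * d)).
  apply: degree_le_sum => x; rewrite -[X in degree_le X]add0n.
  by apply: degree_le_mul => //; apply: degree_le_const.
move=> g; have /rowP/(_ (enum_rank g)) := cM; rewrite !mxE => Z; rewrite -[RHS]Z.
rewrite (reindex (fun u : 'I_#|I| => enum_val u)) /=; last first.
  exact/onW_bij/enum_val_bij.
by apply: eq_bigr => v _; rewrite /c' enum_valK mxE enum_rankK.
Qed.

End Parametrized.

End Growth.

(** * Codimension of nested Schubert varieties *)

Section Codimension.
Variables (C : numFieldType) (n i : nat).
Hypothesis le_in : (i <= n)%N.
Local Notation frame := 'M[C]_(n.+1, i).
Local Notation index s := {x | free_entry (n := n) (i := i) s x}.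
Implicit Types s : 'I_i -> 'I_n.+1.

Lemma cell_frame_degree s t k :
  degree_le 1 (fun y : index s -> C => cell_frame y t k).
Proof.
move=> y x.
exists ((t == s k)%:R%:P +
   oapp (fun x' => if x' == x then 'X else (y x')%:P) 0 (insub (t, k))).
  apply: (leq_trans (size_polyD _ _)); rewrite geq_max; apply/andP; split.
    by rewrite size_polyC; case: (_ != 0).
  case: (insub _) => [x'|] /=; last by rewrite size_poly0.
  by case: eqP => _; rewrite ?size_polyX // size_polyC; case: (_ != 0).
move=> u; rewrite mxE hornerD hornerC; congr (_ + _).
case: (insub _) => [x'|] /=; last by rewrite horner0.
by rewrite /update; case: eqP => _; rewrite ?hornerX ?hornerC.
Qed.

(** The cofactors of row k0 do not involve that row, so they are those of the
    identity matrix. *)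
Lemma det_row_replaced m (k0 : 'I_m) (M : 'M[C]_m) :
  (forall l k, l != k0 -> M l k = (l == k)%:R) -> \det M = M k0 k0.
Proof.
move=> M1; rewrite (expand_det_row _ k0) -[RHS]mulr1.
have cof l : cofactor M k0 l = (l == k0)%:R.
  have -> : cofactor M k0 l = cofactor 1%:M k0 l.
    congr (_ * \det _); apply/matrixP => u v; rewrite !mxE M1 // eq_sym.
    exact: neq_lift.
  have := mul_mx_adj (1%:M : 'M[C]_m); rewrite det1 mul1mx => /matrixP/(_ l k0).
  by rewrite mxE => ->; rewrite mxE.
rewrite (bigD1 k0) //= cof eqxx big1 ?addr0 // => l lk.
by rewrite cof (negPf lk) mulr0.
Qed.

(** The coordinate subspaces of the cell form a chain.  The free entry x is the
    quotient P / Q of two minors: those on the rows s, with and without the row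
    of the leading entry of the column of x replaced by the row of x. *)
Lemma cell_growth (T : finType) (phi : (T -> C) -> frame) s :
  (forall t k, degree_le 1 (fun y => phi y t k)) -> increasing s ->
  growth phi #|{: index s}| (frames_of (cell s)).
Proof.
move=> dphi inc.
suff H (r : seq (index s)) : uniq r -> growth phi (size r) (@coord_frames C n i s (mem r)).
  apply: growth_sub (_ : growth phi _ (@coord_frames C n i s (mem (enum {: index s})))).
    move=> A [y _ ->]; split; first exact: cell_frame_isframe.
    by apply/cellP => //; exists y.
  by rewrite cardE; apply: H; apply: enum_uniq.
elim: r => [_|x r IH /= /andP[xr ur]].
  apply: (@growth_point _ _ _ _ _ _ (cell_frame (s := s) (fun=> 0))).
  by exists (fun=> 0).
pose P (A : frame) := \det (rowsub (fun k => if k == (val x).2 then (val x).1 else s k) A).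
pose Q (A : frame) := \det (rowsub s A).
have HP : form 1 P by apply: form_minor.
have PE (y : index s -> C) : P (cell_frame y) = y x.
  rewrite /P (@det_row_replaced _ (val x).2) => [|l k /negPf lx]; last first.
    rewrite mxE lx; have /matrixP/(_ l k) := cell_frame_minor inc y.
    by rewrite mxE [RHS]mxE.
  rewrite mxE eqxx mxE -surjective_pairing valK /=.
  have /andP[_ xs] := valP x.
  have /negPf -> : (val x).1 != s (val x).2 by apply: contraNneq xs => ->; apply: codom_f.
  by rewrite add0r.
have HQ : form 1 Q by apply: form_minor.
have QE (y : index s -> C) : Q (cell_frame y) = 1 by rewrite /Q cell_frame_minor // det1.
apply: (growth_step dphi _ _ _ HP HQ _ _ _ (IH ur)).
- exact: coord_frames_integral.
- exact: coord_frames_integral.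
- move=> A [y y0 ->]; exists y => // x'; rewrite inE negb_or => /andP[_]; exact: y0.
- by move=> A [y y0 ->]; rewrite PE; apply: y0.
- exists (cell_frame (fun x' => (x' == x)%:R)).
    exists (fun x' => (x' == x)%:R) => // x'.
    by rewrite inE negb_or => /andP[/negPf->].
  by rewrite PE eqxx; apply/eqP; apply: oner_neq0.
- exists (cell_frame (s := s) (fun=> 0)); first by exists (fun=> 0).
  by rewrite QE; apply/eqP; apply: oner_neq0.
Qed.

Lemma zchain_leq s s' c : increasing s -> increasing s' ->
  zchain i (@shape_variety C n i s) (@shape_variety C n i s') c ->
  (#|{: index s}| + c <= #|{: index s'}|)%N.
Proof.
move=> inc inc' [Y [Y0 Yc Yirr Ylt]].
pose phi := @cell_frame C n i s'.
have dphi t k := cell_frame_degree (s := s') t k.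
have Ymono k : (k <= c)%N -> (@shape_variety C n i s `<=` Y k)%classic.
  elim: k => [_|k IH kc]; first by rewrite Y0.
  by apply: (subset_trans (IH (ltnW kc))); apply: (properW (Ylt k kc)).
have cellY k : (k <= c)%N -> frames_of (Y k) (cell_frame (s := s) (fun=> 0)).
  move=> kc; split; first exact: cell_frame_isframe.
  apply: (Ymono k kc); apply: zclosure_sub; first exact: cell_Gr.
  by apply/cellP => //; exists (fun=> 0).
have gr k : (k <= c)%N -> growth phi (#|{: index s}| + k) (frames_of (Y k)).
  elim: k => [_|k IH kc].
    rewrite addn0; apply: growth_sub (cell_growth dphi inc) => A [fA cA].
    by split=> //; rewrite Y0; apply: zclosure_sub => //; apply: cell_Gr.
  have [[clk irrk] [clk1 irrk1]] := (Yirr k (ltnW kc), Yirr k.+1 kc).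
  have [sub nsub] := Ylt k kc.
  have [U [YU nU]] : exists U, Y k.+1 U /\ ~ Y k U.
    apply: contrapT => H; apply: nsub => U YU; apply: contrapT => nU; apply: H; by exists U.
  have [A fA UA] := Gr_frame le_in (proj1 clk1 _ YU); subst U.
  have [r [P [HP vP PA]]] := closed_separation le_in clk fA nU.
  have HQ := form_exp r (form_minor C s); rewrite mul1n in HQ.
  rewrite addnS; apply: (growth_step dphi _ _ _ HP HQ _ _ _ (IH (ltnW kc))).
  - by apply: zirreducible_integral => //; case: clk.
  - by apply: zirreducible_integral => //; case: clk1.
  - by move=> B [fB /sub YB].
  - by move=> B [fB YB]; apply: vP.
  - by exists A.
  - exists (cell_frame (s := s) (fun=> 0)); first exact: cellY (ltnW kc).
    by rewrite cell_frame_minor // det1 expr1n; apply/eqP; apply: oner_neq0.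
apply: (growth_leq _ (gr c (leqnn c))) => r P HP P0 A [fA].
rewrite Yc; apply: (zclosure_vanish le_in (cell_Gr inc') HP) => //.
exact: (cell_frame_vanish inc' HP).
Qed.

Lemma card_free_entries s : increasing s ->
  (#|{: index s}| + \sum_(k < i) k = \sum_k s k)%N.
Proof.
move=> inc; rewrite card_sig -sum1_card (eq_bigl (free_entry s)) //.
rewrite -(pair_big_dep xpredT (fun t k => free_entry s (t, k)) (fun _ _ => 1%N)) /=.
rewrite (exchange_big_dep xpredT) //= -big_split /=; apply: eq_bigr => k _.
rewrite sum1_card.
have -> : nat_of_ord k = #|[pred t : 'I_n.+1 | (t < s k)%N && (t \in codom s)]|.
  have -> : #|[pred t : 'I_n.+1 | (t < s k)%N && (t \in codom s)]| = 
      #|(s @: [set l : 'I_i | (l < k)%N])%SET|.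
    apply: eq_card => t; rewrite inE; apply/idP/imsetP => [/andP[tk /codomP[l tl]]|[l lk ->]].
      exists l => //; rewrite inE ltnNge; apply/negP => kl.
      by move: tk; rewrite tl ltnNge increasing_leq.
    by rewrite inE in lk; rewrite codom_f andbT; apply: inc.
  rewrite card_imset; last exact: increasing_inj.
  by rewrite cardsE -sum1_card (big_ord_narrow (ltnW (ltn_ord k))) sum1_card card_ord.
rewrite addnC.
have skE : nat_of_ord (s k) = #|[pred t : 'I_n.+1 | (t < s k)%N]|.
  by rewrite -sum1_card (big_ord_narrow (ltnW (ltn_ord (s k)))) sum1_card card_ord.
rewrite [RHS]skE -[RHS](cardID (mem (codom s))); congr (_ + _)%N; apply: eq_card => t.
by rewrite unfold_in /= /free_entry /= !inE andbC.
Qed.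

(** The last leading row that still has to move can be raised without meeting
    the next one, which is already in its final place. *)
Lemma zchain_exists s s' m : increasing s -> increasing s' ->
  (forall k, (s k <= s' k)%N) -> (\sum_k s' k = \sum_k s k + m)%N ->
  zchain i (@shape_variety C n i s) (@shape_variety C n i s') m.
Proof.
elim: m s => [|m IH] s inc inc' les.
  rewrite addn0 => E.
  have -> : s = s'.
    apply/funext => k; apply/val_inj/eqP; rewrite eqn_leq les /=.
    have D f : (\sum_l f l = f k + \sum_(l | l != k) f l)%N by rewrite (bigD1 k).
    move: E; rewrite !D.
    have : (\sum_(l | l != k) s l <= \sum_(l | l != k) s' l)%N by apply: leq_sum.
    lia.
  exists (fun=> @shape_variety C n i s'); split=> // k _.
  by split; [apply: shape_variety_closed|apply: shape_variety_irreducible].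
move=> E.
have [k1 k1P] : exists k, (s k < s' k)%N.
  apply/existsP/contraT => /existsPn H.
  have : (\sum_k s' k <= \sum_k s k)%N by apply: leq_sum => k _; rewrite leqNgt.
  lia.
have [k0 k0P k0max] := @arg_maxnP _ k1 (fun k => (s k < s' k)%N) (@nat_of_ord i) k1P.
have lt0 : ((s k0).+1 < n.+1)%N by apply: leq_ltn_trans (ltn_ord (s' k0)).
pose s1 k := if k == k0 then Ordinal lt0 else s k.
have s1k0 : s1 k0 = (s k0).+1 :> nat by rewrite /s1 eqxx.
have s1k k : k != k0 -> s1 k = s k by move=> /negPf; rewrite /s1 => ->.
have inc1 : increasing s1.
  move=> a b ab; have [ak|ak] := eqVneq a k0.
    have bk : b != k0 by rewrite -val_eqE -ak /= (gtn_eqF ab).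
    rewrite (s1k b bk) ak s1k0; have : (s' b <= s b)%N.
      rewrite leqNgt; apply/negP => /k0max; rewrite -ak; lia.
    have := inc' a b ab; rewrite ak; lia.
  rewrite (s1k a) //; have [bk|bk] := eqVneq b k0; last by rewrite s1k //; apply: inc.
  rewrite bk s1k0; have := inc a b ab; rewrite bk; lia.
have les1 k : (s1 k <= s' k)%N.
  by have [->|kk] := eqVneq k k0; [rewrite s1k0|rewrite s1k].
have [|Y [Y0 Ym Yirr Ylt]] := IH s1 inc1 inc' les1.
  rewrite E (bigD1 k0) //= [in RHS](bigD1 k0) //= s1k0.
  rewrite [in RHS](eq_bigr (fun k => nat_of_ord (s k))); first by lia.
  by move=> k kk; rewrite s1k.
exists (fun k => if k is k'.+1 then Y k' else @shape_variety C n i s); split=> //.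
- case=> [_|k km]; last exact: Yirr.
  by split; [apply: shape_variety_closed|apply: shape_variety_irreducible].
- case=> [_|k km]; last exact: Ylt.
  rewrite Y0; exact: (shape_step_proper C le_in inc inc1 s1k0 s1k).
Qed.

Theorem shape_codim s s' m : increasing s -> increasing s' ->
  (forall k, (s k <= s' k)%N) -> (\sum_k s' k = \sum_k s k + m)%N ->
  is_codim i (@shape_variety C n i s) (@shape_variety C n i s') m.
Proof.
move=> inc inc' les E; split; first exact: zchain_exists.
move=> c /(zchain_leq inc inc').
by have := card_free_entries inc; have := card_free_entries inc'; lia.
Qed.

End Codimension.

(** * Lengths, inversions and minimal representatives *)

Section WeylCombinatorics.
Variable n : nat.
Local Notation ord := 'I_n.+1.
Implicit Types (w u v : 'S_n.+1) (x y : ord).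

(** Pairs of values, not of positions: (x, y) stands for the root e_x - e_y of
    the inversion set w Delta^- /\ Delta^+. *)
Definition inv_set w : {set ord * ord} :=
  [set z : ord * ord | (z.1 < z.2)%N && ((w^-1)%g z.2 < (w^-1)%g z.1)%N].

Lemma inv_setE w x y : ((x, y) \in inv_set w) = (x < y)%N && ((w^-1)%g y < (w^-1)%g x)%N.
Proof. by rewrite inE. Qed.

Lemma simple_reflE (j : 'I_n) x :
  simple_refl n j.+1 x =
  (if x == j :> nat then j.+1 else if x == j.+1 :> nat then nat_of_ord j else x)
  :> nat.
Proof.
have j1 : (inord j : ord) = j :> nat by rewrite inordK // ltnS ltnW.
have j2 : (inord j.+1 : ord) = j.+1 :> nat by rewrite inordK // ltnS.
rewrite /simple_refl /=; case: tpermP => [->|->|xj xj1].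
- by rewrite j1 eqxx.
- by rewrite j2 eqxx (gtn_eqF (ltnSn j)).
- case: eqP => [E|_]; first by case: xj; apply: val_inj; rewrite /= j1.
  by case: eqP => [E|_] //; case: xj1; apply: val_inj; rewrite /= j2.
Qed.

Lemma simple_reflK (j : 'I_n) : involutive (simple_refl n j.+1).
Proof. exact: tpermK. Qed.

Lemma mul_reflV w (j : 'I_n) x :
  ((w * simple_refl n j.+1)^-1)%g x = (w^-1)%g (simple_refl n j.+1 x).
Proof. by rewrite invMg permM tpermV. Qed.

(** The reflection permutes all pairs but (j, j+1), which changes status. *)
Lemma inv_set_refl w (j : 'I_n) :
  (#|inv_set (w * simple_refl n j.+1)%g| + ((w^-1)%g (inord j.+1) < (w^-1)%g (inord j))%N =
   #|inv_set w| + ((w^-1)%g (inord j) < (w^-1)%g (inord j.+1))%N)%N.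
Proof.
set s := simple_refl n j.+1; set a : ord := inord j; set b : ord := inord j.+1.
have aE : a = j :> nat by rewrite inordK // ltnS ltnW.
have bE : b = j.+1 :> nat by rewrite inordK // ltnS.
have sa : s a = b by apply: val_inj; rewrite /= simple_reflE aE eqxx bE.
have sb : s b = a by rewrite -sa simple_reflK.
pose f (z : ord * ord) := (s z.1, s z.2).
have fI : injective f by move=> [x y] [x' y'] [/perm_inj-> /perm_inj->].
have smono x y : (x < y)%N -> (x, y) != (a, b) -> (s x < s y)%N.
  move=> xy; rewrite xpair_eqE -!val_eqE /= aE bE !simple_reflE; do ?case: ifP; move: xy; lia.
have fE : f @: (inv_set w :\ (a, b)) = inv_set (w * s)%g :\ (a, b).
  apply/setP => -[x y]; apply/imsetP/idP.
    case=> -[x' y']; rewrite !inE /= => /andP[n' /andP[xy wxy]] [-> ->].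
    rewrite !mul_reflV !simple_reflK wxy (smono _ _ xy n') /= andbT.
    rewrite xpair_eqE; apply/negP => /andP[/eqP sx /eqP sy].
    have : (s a < s b)%N; last by rewrite sa sb aE bE ltnNge leqnSn.
    by rewrite -sx -sy !simple_reflK.
  rewrite !inE /= !mul_reflV => /andP[nab /andP[xy wxy]].
  exists (s x, s y); last by rewrite /f /= !simple_reflK.
  rewrite !inE /= wxy (smono _ _ xy nab) /= andbT.
  rewrite xpair_eqE; apply/negP => /andP[/eqP sx /eqP sy].
  move: xy; rewrite -[x](simple_reflK j) -[y](simple_reflK j) -/s sx sy sa sb aE bE.
  by rewrite ltnNge leqnSn.
rewrite (cardsD1 (a, b) (inv_set w)) (cardsD1 (a, b) (inv_set (w * s)%g)) -fE card_imset //.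
rewrite !inv_setE !mul_reflV sa sb aE bE ltnSn /= addnAC [RHS]addnAC.
by congr (_ + _)%N; rewrite addnC.
Qed.

Lemma inv_set_refl_leq w (j : 'I_n) :
  (#|inv_set (w * simple_refl n j.+1)%g| <= #|inv_set w|.+1)%N.
Proof.
have := inv_set_refl w j; set b := nat_of_bool (_ < _)%N; set c := nat_of_bool _ => E.
have c1 : (c <= 1)%N by apply: leq_b1.
by rewrite (leq_trans (leq_addr b _)) // E -[X in (_ <= X)%N]addn1 leq_add2l.
Qed.

Lemma inv_set1 : inv_set 1%g = finset.set0.
Proof. by apply/setP => -[x y]; rewrite !inE invg1 !perm1 /=; lia. Qed.

Lemma inv_set_word w m : word_of_size w m -> (#|inv_set w| <= m)%N.
Proof.
case/existsP => t /eqP ->; rewrite -[X in (_ <= X)%N](size_tuple t).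
elim/last_ind: (tval t) => [|r j IH]; first by rewrite big_nil inv_set1 cards0.
rewrite -cats1 big_cat big_seq1 size_cat addn1 /=.
exact: leq_trans (inv_set_refl_leq _ _) _.
Qed.

Lemma adjacent_increasing (f : nat -> nat) lo hi :
  (forall x : nat, (lo <= x)%N -> (x.+1 < hi)%N -> (f x < f x.+1)%N) ->
  forall x y : nat, (lo <= x)%N -> (x < y)%N -> (y < hi)%N -> (f x < f y)%N.
Proof.
move=> adj x y lox; elim: y => // y IH; rewrite ltnS leq_eqVlt => /orP[/eqP <-|xy] yhi.
  exact: adj.
by apply: ltn_trans (IH xy (ltnW yhi)) (adj y _ yhi); lia.
Qed.

Lemma adjacent_increasing_ord (f : ord -> ord) (lo hi : nat) : (hi <= n.+1)%N ->
  (forall j : 'I_n, (lo <= j)%N -> (j.+1 < hi)%N -> (f (inord j) < f (inord j.+1))%N) ->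
  forall x y, (lo <= x)%N -> (x < y)%N -> (y < hi)%N -> (f x < f y)%N.
Proof.
move=> hin adj x y lox xy yhi; rewrite -(inord_val x) -(inord_val y).
apply: (@adjacent_increasing (fun z => f (inord z)) lo hi) => // z loz zhi.
have zn : (z < n)%N by lia.
exact: (adj (Ordinal zn)).
Qed.

Lemma increasing_perm_leq w : (forall x y, (x < y)%N -> (w x < w y)%N) ->
  forall x, (x <= w x)%N.
Proof.
move=> inc x; rewrite -(inord_val x); elim: (nat_of_ord x) (ltn_ord x) => [_|m IH mn].
  by rewrite inordK.
rewrite inordK //; have mn' := ltnW mn.
apply: leq_ltn_trans (_ : (w (inord m) < _)%N); last by apply: inc; rewrite !inordK.
by have := IH mn'; rewrite inordK.
Qed.

Lemma increasing_perm1 w : (forall x y, (x < y)%N -> ((w^-1)%g x < (w^-1)%g y)%N) -> w = 1%g.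
Proof.
move=> inc.
have inc' x y : (x < y)%N -> (w x < w y)%N.
  move=> xy; case: (ltngtP (w x) (w y)) => // [/inc|/val_inj/perm_inj E].
    by rewrite !permK => /ltn_trans/(_ xy); rewrite ltnn.
  by rewrite E ltnn in xy.
apply/permP => x; rewrite perm1; apply/val_inj/eqP; rewrite eqn_leq.
rewrite (increasing_perm_leq inc') andbT.
by have := increasing_perm_leq inc (w x); rewrite permK.
Qed.

Lemma word_of_inv_set w : word_of_size w #|inv_set w|.
Proof.
have [m] := ubnP #|inv_set w|; elim: m w => // m IH w; rewrite ltnS => wm.
case: (boolP [exists j : 'I_n, ((w^-1)%g (inord j.+1) < (w^-1)%g (inord j))%N]).
  case/existsP => j jw; set s := simple_refl n j.+1.
  have E : (#|inv_set (w * s)%g|.+1 = #|inv_set w|)%N.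
    have := inv_set_refl w j; rewrite -/s jw addn1 => ->.
    by rewrite ltnNge (ltnW jw) addn0.
  have /existsP[t /eqP tE] : word_of_size (w * s)%g #|inv_set (w * s)%g|.
    by apply: IH; rewrite E.
  rewrite -E; apply/existsP; exists [tuple of rcons t j]; apply/eqP.
  rewrite /= -cats1 big_cat big_seq1 /= -tE -mulgA.
  have -> : (s * s = 1)%g by apply/permP => x; rewrite permM perm1 simple_reflK.
  by rewrite mulg1.
move/existsPn => asc.
have -> : w = 1%g.
  apply: increasing_perm1 => x y xy.
  apply: (@adjacent_increasing_ord _ 0 n.+1) => // j _ _.
  case: ltngtP (asc j) => // /val_inj/perm_inj/(congr1 val) /=.
  by rewrite !inordK ?ltnS // 1?ltnW //; lia.
rewrite inv_set1 cards0; apply/existsP; exists [tuple]; by rewrite big_nil.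
Qed.

Lemma weyl_lengthE w : weyl_length w = #|inv_set w|.
Proof.
rewrite /weyl_length; case: ex_minnP => m wm minm; apply/eqP; rewrite eqn_leq.
by rewrite minm ?word_of_inv_set // inv_set_word.
Qed.

Section Parabolic.
Variable i : nat.

(** The minimal length representatives of the cosets of the parabolic subgroup,
    see min_repP. *)
Definition grassmannian w :=
  forall x y, (x < y)%N -> (y < i)%N || (i <= x)%N -> ((w^-1)%g x < (w^-1)%g y)%N.

Lemma grassmannian_inv_set w x y : grassmannian w -> (x, y) \in inv_set w ->
  (x < i <= y)%N.
Proof.
move=> gw; rewrite inv_setE => /andP[xy wyx].
have := gw x y xy; case: (ltnP y i) => yi; case: (ltnP x i) => xi //= /(_ isT).
all: by rewrite ltnNge (ltnW wyx).
Qed.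

Lemma weyl_p_block u : u \in weyl_p n i -> forall x, (u x < i)%N = (x < i)%N.
Proof.
case/gen_prodgP => m [c cS ->].
elim/big_ind: _ => [x|a b Ha Hb x|k _ x]; first by rewrite perm1.
  by rewrite permM Hb Ha.
have /imsetP[j] := cS k; rewrite inE => ji ->.
rewrite simple_reflE; case: eqP => [->|_]; last by case: eqP => [->|//]; lia.
by lia.
Qed.

(** A descent of w at j <> i could be removed inside the coset; conversely the
    inversions of w are pairs x < i <= y, and a permutation u of the parabolic
    subgroup, preserving both blocks, maps them to inversions of w * u. *)
Lemma min_repP w : (i <= n)%N -> min_rep i w <-> grassmannian w.
Proof.
move=> le_in; split=> [minw|gw u uP].
  have asc (j : 'I_n) : j.+1 != i -> ((w^-1)%g (inord j) < (w^-1)%g (inord j.+1))%N.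
    move=> ji; have /minw : simple_refl n j.+1 \in weyl_p n i.
      by apply/mem_gen/imsetP; exists j; rewrite ?inE.
    rewrite !weyl_lengthE; have := inv_set_refl w j.
    case: (ltngtP ((w^-1)%g (inord j)) ((w^-1)%g (inord j.+1))) => //=.
      by move=> _; rewrite addn1 addn0 => <-; rewrite ltnn.
    move=> /val_inj/perm_inj/(congr1 val) /= E; exfalso; move: E.
    by rewrite !inordK ?ltnS // 1?ltnW //; lia.
  move=> x y xy /orP[yi|ix].
    apply: (@adjacent_increasing_ord _ 0 i) => //; first exact: leqW.
    by move=> j _ ji; apply: asc; rewrite neq_ltn ji.
  apply: (@adjacent_increasing_ord _ i n.+1) => //.
  by move=> j ij _; apply: asc; rewrite neq_ltn ltnS ij orbT.
rewrite !weyl_lengthE; pose f (z : ord * ord) := (u z.1, u z.2).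
have fI : injective f by move=> [x y] [x' y'] [/perm_inj-> /perm_inj->].
rewrite -(card_imset (mem (inv_set w)) fI); apply/subset_leq_card/fintype.subsetP => z.
case/imsetP => -[x y] xy ->; have /andP[xi iy] := grassmannian_inv_set gw xy.
rewrite !inE /= invMg !permM !permK; move: xy; rewrite inv_setE => /andP[_ ->].
rewrite andbT; apply: (@leq_trans i); first by rewrite weyl_p_block.
by rewrite leqNgt weyl_p_block // -leqNgt.
Qed.

(** The values taken before position w^-1(x) are those smaller than x and the
    columns of the boxes in row x. *)
Lemma grassmannian_row w x : grassmannian w -> (x < i)%N ->
  ((w^-1)%g x = x + #|[set y | (x, y) \in inv_set w]| :> nat)%N.
Proof.
move=> gw xi.
have -> : nat_of_ord ((w^-1)%g x) = #|[set z : ord | ((w^-1)%g z < (w^-1)%g x)%N]|.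
  have -> : [set z : ord | ((w^-1)%g z < (w^-1)%g x)%N] =
            w @: [set t : ord | (t < (w^-1)%g x)%N].
    apply/setP => z; rewrite inE; apply/idP/imsetP => [zx|[t]].
      by exists ((w^-1)%g z); rewrite ?inE ?permKV.
    by rewrite inE => tx ->; rewrite permK.
  rewrite card_imset; last exact: perm_inj.
  by rewrite cardsE -sum1_card (big_ord_narrow (ltnW (ltn_ord _))) sum1_card card_ord.
have xE : nat_of_ord x = #|[set z : ord | (z < x)%N]|.
  by rewrite cardsE -sum1_card (big_ord_narrow (ltnW (ltn_ord _))) sum1_card card_ord.
rewrite [X in (X + _)%N]xE -cardsUI [X in (_ + X)%N](_ : _ = 0%N) ?addn0; last first.
  apply/eqP; rewrite cards_eq0 -finset.subset0; apply/fintype.subsetP => y.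
  by rewrite !inE /=; lia.
congr #|pred_of_set _|; apply/setP => z; rewrite !inE /=.
case: (ltngtP z x) => zx /=; last by rewrite (val_inj zx) ltnn.
  by apply: gw => //; rewrite xi.
by [].
Qed.

Lemma grassmannian_row_leq w x : (i <= n)%N -> grassmannian w -> (x < i)%N ->
  ((w^-1)%g x + i <= x + n.+1)%N.
Proof.
move=> le_in gw xi; rewrite (grassmannian_row gw xi) -addnA leq_add2l.
have E : (n.+1 = #|[set y : ord | (i <= y)%N]| + i)%N.
  rewrite -{1}(card_ord n.+1) -(cardsC [set y : ord | (i <= y)%N]); congr (_ + _)%N.
  rewrite -[RHS](card_ord i) -[RHS](card_imset predT (f := widen_ord (leqW le_in))).
    apply: eq_card => y; rewrite !inE -ltnNge; apply/idP/imsetP => [yi|[z _ ->]] /=.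
      by exists (Ordinal yi) => //; apply: val_inj.
    exact: ltn_ord.
  by move=> a b /(congr1 val) /= /val_inj.
rewrite [X in (_ <= X)%N]E leq_add2r; apply/subset_leq_card/fintype.subsetP => y.
rewrite inE => /(grassmannian_inv_set gw).
by rewrite inE => /andP[].
Qed.

End Parabolic.

End WeylCombinatorics.

Lemma card_interval m (a b : nat) : (b <= m)%N -> #|[set y : 'I_m | (a <= y < b)%N]| = (b - a)%N.
Proof.
elim: b => [_|b IH bm].
  apply/eqP; rewrite sub0n cards_eq0 -finset.subset0; apply/fintype.subsetP => y.
  by rewrite inE ltn0 andbF.
case: (leqP a b) => ab; last first.
  have -> : [set y : 'I_m | (a <= y < b.+1)%N] = [set y : 'I_m | (a <= y < b)%N].
    by apply/setP => y; rewrite !inE; lia.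
  by rewrite IH ?(ltnW bm) //; lia.
have -> : [set y : 'I_m | (a <= y < b.+1)%N] = Ordinal bm |: [set y : 'I_m | (a <= y < b)%N].
  apply/setP => y; rewrite !inE -val_eqE /=; lia.
rewrite cardsU1 inE /= ltnn andbF IH ?(ltnW bm) // subSn //.
Qed.

(** * Grassmannian permutations and shapes *)

Section Grassmannian.
Variables (n i : nat).
Hypothesis le_in : (i <= n)%N.
Local Notation ord := 'I_n.+1.
Local Notation wide := (widen_ord (leqW le_in)).

(** The boxes of row x are its first w^-1(x) - x columns. *)
Lemma grassmannian_inv_row w (x y : ord) : grassmannian i w -> (x < i)%N -> (i <= y)%N ->
  ((x, y) \in inv_set w) = (y + x < i + (w^-1)%g x)%N.
Proof.
move=> gw xi iy; rewrite (grassmannian_row gw xi).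
set R := [set y' | (x, y') \in inv_set w].
case: (boolP ((x, y) \in inv_set w)) => xy.
  have : (#|[set y' : ord | (i <= y' < y.+1)%N]| <= #|R|)%N.
    apply/subset_leq_card/fintype.subsetP => y'; rewrite !inE /= => /andP[iy'].
    rewrite ltnS leq_eqVlt => /orP[/eqP/val_inj->|yy]; first by move: xy; rewrite inE.
    move: xy; rewrite inE /= => /andP[xy wyx]; rewrite (leq_trans xi iy') /=.
    by apply: ltn_trans wyx; apply: gw; rewrite // iy' orbT.
  by rewrite card_interval ?ltn_ord //; lia.
have : (#|R| <= #|[set y' : ord | (i <= y' < y)%N]|)%N.
  apply/subset_leq_card/fintype.subsetP => y'; rewrite [y' \in R]inE => xy'.
  have /andP[_ iy'] := grassmannian_inv_set gw xy'.
  rewrite inE iy' /= ltnNge; apply: contra xy; move: xy'; rewrite !inE /= => /andP[xy' wyx].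
  rewrite leq_eqVlt (leq_trans xi iy) /= => /orP[/eqP/val_inj->//|yy].
  by apply: ltn_trans wyx; apply: gw; rewrite // iy orbT.
by rewrite card_interval ?(ltnW (ltn_ord _)) //; lia.
Qed.

Definition shape (w : 'S_n.+1) (k : 'I_i) : ord := (w^-1)%g (wide k).

Lemma shape_increasing w : grassmannian i w -> increasing (shape w).
Proof. by move=> gw a b ab; apply: gw; rewrite //= ltn_ord. Qed.

(** The values below i are placed at the positions s, the others in increasing
    order at the remaining positions. *)
Lemma grassmannian_exists (s : 'I_i -> ord) : increasing s ->
  exists2 v, grassmannian i v & shape v =1 s.
Proof.
move=> inc.
pose L1 := [seq s k | k <- enum 'I_i]; pose L2 := [seq t <- enum ord | t \notin codom s].
have sL1 : size L1 = i by rewrite size_map size_enum_ord.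
have uL : uniq (L1 ++ L2).
  rewrite cat_uniq (map_inj_uniq (increasing_inj inc)) enum_uniq.
  rewrite (filter_uniq _ (enum_uniq _)) andbT /=.
  by apply/hasPn => t; rewrite mem_filter => /andP[].
have sL : size (L1 ++ L2) = n.+1.
  rewrite -(card_uniqP uL) -[RHS](card_ord n.+1); apply: eq_card => t.
  rewrite mem_cat mem_filter mem_enum andbT inE -/(codom s).
  by rewrite -[t \in L1]/(t \in codom s) orbN.
pose f (x : ord) := nth ord0 (L1 ++ L2) x.
have fI : injective f.
  by move=> x y /eqP; rewrite nth_uniq ?sL // => /eqP/val_inj.
pose v := (perm fI)^-1%g.
have vE x : (v^-1)%g x = f x by rewrite /v invgK permE.
have L1E (k : 'I_i) : nth ord0 L1 k = s k.
  by rewrite (nth_map k) ?size_enum_ord // nth_ord_enum.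
exists v; last first.
  by move=> k; rewrite /shape vE /f nth_cat sL1 /= ltn_ord L1E.
have ord_sorted m : sorted (fun a b : 'I_m => (a < b)%N) (enum 'I_m).
  by have := iota_ltn_sorted 0 m; rewrite -val_enum_ord sorted_map.
have tr : transitive (fun a b : ord => (a < b)%N) by move=> a b c; apply: ltn_trans.
move=> x y xy /orP[yi|ix]; rewrite !vE /f !nth_cat sL1.
  rewrite yi (ltn_trans xy yi); have xi := ltn_trans xy yi.
  by rewrite (L1E (Ordinal xi)) (L1E (Ordinal yi)); apply: inc.
rewrite !ltnNge ix (leq_trans ix (ltnW xy)) /= -ltnNge.
have sL2 : size L2 = (n.+1 - i)%N.
  by have := sL; rewrite size_cat sL1 => /(congr1 (subn^~ i)); rewrite addKn.
have sortL2 : sorted (fun a b : ord => (a < b)%N) L2 by apply: sorted_filter.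
apply: (sorted_ltn_nth tr ord0 sortL2); rewrite ?inE ?sL2.
all: have := ltn_ord x; have := ltn_ord y; lia.
Qed.

Lemma sum_shape w : grassmannian i w ->
  (\sum_k shape w k = \sum_(k < i) k + #|inv_set w|)%N.
Proof.
move=> gw; transitivity (\sum_(k < i) (k + #|[set y | (wide k, y) \in inv_set w]|))%N.
  by apply: eq_bigr => k _; rewrite (grassmannian_row gw) //=.
rewrite big_split /=; congr (_ + _)%N.
rewrite -[RHS]sum1_card (eq_bigl (fun z => (z.1, z.2) \in inv_set w)); last by case.
rewrite -(pair_big_dep xpredT (fun x y => (x, y) \in inv_set w) (fun _ _ => 1%N)) /=.
rewrite (bigID (fun x : ord => (x < i)%N)) /= [X in (_ + X)%N]big1 => [|x xi]; last first.
  rewrite big1 // => y /(grassmannian_inv_set gw) /andP[]; lia.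
rewrite addn0 (big_ord_narrow (leqW le_in)) /=; apply: eq_bigr => k _.
by rewrite sum1_card; apply: eq_card => y; rewrite inE.
Qed.

Lemma schubert_shape (C : numFieldType) w : grassmannian i w ->
  schubert C i w = @shape_variety C n i (shape w).
Proof.
move=> gw; rewrite /schubert /shape_variety -(borel_cell C (shape_increasing gw)).
by rewrite weyl_point_span.
Qed.

(** The sum of the shape of w exceeds that of the identity by the number of
    inversions, and that sum counts the elementary moves between shapes. *)
Lemma schubert_codim (C : numFieldType) (v w : 'S_n.+1) : grassmannian i v -> grassmannian i w ->
  inv_set v \subset inv_set w ->
  is_codim i (schubert C i v) (schubert C i w) #|(inv_set w :\: inv_set v)%SET|.
Proof.
move=> gv gw vw; rewrite !schubert_shape //; apply: shape_codim => //.
- exact: shape_increasing.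
- exact: shape_increasing.
- move=> k; have ki : (wide k < i)%N := ltn_ord k.
  rewrite /shape (grassmannian_row gv ki) (grassmannian_row gw ki) leq_add2l.
  apply/subset_leq_card/fintype.subsetP => y kv.
  by rewrite inE in kv; rewrite inE; apply: (fintype.subsetP vw).
- rewrite !sum_shape // -addnA; congr (_ + _)%N.
  by rewrite -(cardsID (inv_set v) (inv_set w)) (finset.setIidPr vw).
Qed.

End Grassmannian.

(** * Roots, root spaces and gradings *)

Section RootData.
Variables (C : numFieldType) (n i : nat).
Local Notation ord := 'I_n.+1.
Local Notation rt x y := (eps x - eps y : weight n).
Implicit Types (x y s t : ord) (w : 'S_n.+1).

Lemma rtE x y s : (rt x y) 0%R s = ((s == x)%:R - (s == y)%:R)%R :> int.
Proof. by rewrite !mxE. Qed.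

Lemma rt_inj x y s t : x != y -> rt x y = rt s t -> x = s /\ y = t.
Proof.
move=> xy /rowP E.
have := E x; have := E y; rewrite !rtE !eqxx (negPf xy) [y == x]eq_sym (negPf xy).
by case: eqP => [->|_]; case: eqP => [->|_] //; case: eqP => [->|_] //; case: eqP => [->|_].
Qed.

Lemma rt_eq x y s t : x != y -> (rt x y == rt s t) = ((x, y) == (s, t)).
Proof.
move=> xy; apply/eqP/eqP => [/(rt_inj xy)[-> ->]//|[-> ->]//].
Qed.

Lemma rt_oppr x y : - (rt x y) = rt y x.
Proof. by rewrite opprB. Qed.

Lemma rootsP al : reflect (exists x y, x != y /\ al = rt x y) (al \in Defs.roots n).
Proof.
apply: (iffP mapP) => [[[x y]]|[x [y [xy ->]]]].
  by rewrite mem_filter /= => /andP[xy _] ->; exists x, y.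
by exists (x, y); rewrite // mem_filter xy mem_enum.
Qed.

Lemma pos_rootsP al : reflect (exists x y, (x < y)%N /\ al = rt x y) (al \in pos_roots n).
Proof.
apply: (iffP mapP) => [[[x y]]|[x [y [xy ->]]]].
  by rewrite mem_filter /= => /andP[xy _] ->; exists x, y.
by exists (x, y); rewrite // mem_filter /= xy mem_enum.
Qed.

Lemma rt_roots x y : (rt x y \in Defs.roots n) = (x != y).
Proof.
apply/rootsP/idP => [[s [t [st E]]]|xy]; last by exists x, y.
by have [<- <-] := rt_inj st (esym E).
Qed.

(** The difference has positive coefficients at x and at t, or the coefficient 2
    at x = t, while a root has a single positive coefficient, equal to 1. *)
Lemma rt_sub_notin x y s t : x != y -> s != t -> x != s -> y != t ->
  rt x y - rt s t \notin Defs.roots n.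
Proof.
move=> xy st xs yt; apply/rootsP => -[u [v [uv /rowP E]]].
have ev z : (z == x)%:R - (z == y)%:R - ((z == s)%:R - (z == t)%:R) =
    (z == u)%:R - (z == v)%:R :> int by have := E z; rewrite -!rtE !mxE.
have xu : x = u.
  apply/eqP; move: (ev x); rewrite eqxx (negPf xy) (negPf xs).
  by case: (x == t); case: (x == u); case: (x == v).
have tu : t = u.
  apply/eqP; move: (ev t).
  rewrite eqxx [t == y]eq_sym (negPf yt) [t == s]eq_sym (negPf st).
  by case: (t == x); case: (t == u); case: (t == v).
have xt : x == t by rewrite xu tu.
by move: (ev x); rewrite eqxx (negPf xy) (negPf xs) xt -xu eqxx; case: (x == v).
Qed.

Lemma rt_pos_roots x y : (rt x y \in pos_roots n) = (x < y)%N.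
Proof.
apply/pos_rootsP/idP => [[s [t [st E]]]|xy]; last by exists x, y.
have nst : s != t by rewrite -val_eqE (ltn_eqF st).
by have [<- <-] := rt_inj nst (esym E).
Qed.

Lemma weyl_act_rt w x y : weyl_act w (rt x y) = rt (w x) (w y).
Proof.
apply/rowP => s; rewrite mxE !rtE.
by rewrite -(inj_eq (@perm_inj _ w) (w^-1 s)%g x) -(inj_eq (@perm_inj _ w) (w^-1 s)%g y) permKV.
Qed.

Lemma inversionsE w x y : (rt x y \in inversions w) = ((x, y) \in inv_set w).
Proof.
rewrite mem_filter rt_pos_roots inE /=; case: ltnP => //= xy.
apply/mapP/idP => [[be /mapP[[s t]]]|wyx].
  rewrite mem_filter /= => /andP[ts _] ->; rewrite weyl_act_rt => E.
  have nxy : x != y by rewrite -val_eqE (ltn_eqF xy).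
  by have [-> ->] := rt_inj nxy E; rewrite !permK.
exists (rt (w^-1 x)%g (w^-1 y)%g); last by rewrite weyl_act_rt !permKV.
by apply/mapP; exists ((w^-1 x)%g, (w^-1 y)%g); rewrite // mem_filter /= wyx mem_enum.
Qed.

Lemma inversions_rt w al : al \in inversions w ->
  exists x y, al = rt x y /\ (x, y) \in inv_set w.
Proof.
move=> al_w; have := al_w; rewrite mem_filter => /andP[/pos_rootsP[x [y [xy E]]] _].
by exists x, y; rewrite -inversionsE -E.
Qed.

Lemma inversions_uniq w : uniq (inversions w).
Proof.
apply: filter_uniq; rewrite map_inj_uniq.
  rewrite map_inj_in_uniq; first exact: filter_uniq (enum_uniq _).
  move=> -[x y] [s t].
  rewrite !mem_filter /= => /andP[yx _] /andP[_ _] E.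
  have nxy : x != y by rewrite -val_eqE (gtn_eqF yx).
  by have [-> ->] := rt_inj nxy E.
move=> a b /rowP E; apply/rowP => s; have := E (w s).
by rewrite !mxE permK.
Qed.


Lemma lie_diag (Z A : 'M[C]_n.+1) s t : is_diag_mx Z ->
  lie Z A s t = (Z s s - Z t t) * A s t.
Proof.
move=> /is_diag_mxP Z0; rewrite /lie mxE [X in _ + X]mxE [X in X - _]mxE [X in _ - X]mxE.
rewrite (bigD1 s) //= big1 => [|u us]; last by rewrite Z0 ?mul0r // eq_sym.
rewrite (bigD1 t) //= [X in _ - (_ + X)]big1 => [|u ut]; last by rewrite Z0 ?mulr0.
by rewrite !addr0 mulrBl [A s t * _]mulrC.
Qed.

Lemma weight_eval_rt x y (H : 'M[C]_n.+1) : weight_eval (rt x y) H = H x x - H y y.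
Proof.
have sumE a : \sum_b (b == a)%:R * H b b = H a a.
  by rewrite (bigD1 a) //= eqxx mul1r big1 ?addr0 // => b /negPf->; rewrite mul0r.
rewrite /weight_eval -!sumE -sumrB; apply: eq_bigr => b _.
by rewrite rtE rmorphB /= mulrBl; case: eqP => _; case: eqP.
Qed.

(** Roots only see differences of diagonal entries, so the trace can be
    corrected by a scalar matrix. *)
Lemma cartan_diff (v : ord -> C) : exists2 H, cartan H &
  forall s t, H s s - H t t = v s - v t.
Proof.
pose m := (\sum_s v s) / n.+1%:R.
exists (diag_mx (\row_s (v s - m))); last first.
  by move=> s t; rewrite !mxE !eqxx !mulr1n opprB addrA subrK.
split; last exact: diag_mx_is_diag.
rewrite /sl /= mxtrace_diag; under eq_bigr do rewrite mxE.
rewrite sumrB sumr_const card_ord -[_ *+ n.+1]mulr_natr /m divfK ?subrr //.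
by rewrite pnatr_eq0.
Qed.

(** The torus elements with a single entry 1, at x or at y, already force the
    matrix to be concentrated at (x, y). *)
Lemma root_spaceP x y A : x != y ->
  root_space (C := C) (rt x y) A <-> exists c, A = c *: delta_mx x y.
Proof.
move=> xy; split=> [[_ HA]|[c ->]].
  have E v s t : (v s - v t) * A s t = (v x - v y) * A s t.
    have [H cH Hv] := cartan_diff v.
    have /matrixP/(_ s t) := HA H cH.
    by rewrite lie_diag ?(proj2 cH) // weight_eval_rt !Hv mxE.
  exists (A x y); apply/matrixP => s t; rewrite !mxE.
  have := E (fun u => (u == x)%:R) s t; rewrite eqxx [y == x]eq_sym (negPf xy) subr0 mul1r.
  have := E (fun u => (u == y)%:R) s t; rewrite eqxx (negPf xy) sub0r mulN1r.
  have [->|sx] := eqVneq s x; last first.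
    rewrite sub0r /= mulr0 => _ /eqP; rewrite mulNr -subr_eq0 -opprD oppr_eq0.
    case: (t == x); first by rewrite mul1r -mulr2n -mulr_natr mulf_eq0 pnatr_eq0 orbF => /eqP.
    by rewrite mul0r add0r => /eqP.
  have [->|ty] := eqVneq t y; first by rewrite /= mulr1.
  by rewrite (negPf xy) subrr mul0r mulr0 => /esym/eqP; rewrite oppr_eq0 => /eqP.
split.
  rewrite /sl /= /mxtrace big1 // => s _; rewrite !mxE.
  by case: eqP => [->|_]; rewrite ?(negPf xy) mulr0.
move=> H [_ dH]; apply/matrixP => s t; rewrite lie_diag // weight_eval_rt !mxE.
by case: eqP => [->|_]; case: eqP => [->|_]; rewrite /= ?mulr0.
Qed.

Lemma root_space_ad x y (Z : 'M[C]_n.+1) k : x != y -> is_diag_mx Z ->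
  (root_space (rt x y) `<=` [set A | sl A /\ lie Z A = k *: A])%classic <-> Z x x - Z y y = k.
Proof.
move=> xy dZ; split=> [sub|<- A rA].
  have /sub[_ /matrixP/(_ x y)] : root_space (rt x y) (delta_mx x y : 'M[C]_n.+1).
    by apply/root_spaceP => //; exists 1; rewrite scale1r.
  by rewrite lie_diag // !mxE !eqxx !mulr1.
split; first by case: rA.
have /root_spaceP[//|c ->] := rA.
apply/matrixP => s t; rewrite lie_diag // !mxE.
by case: eqP => [->|_]; case: eqP => [->|_]; rewrite /= ?mulr0.
Qed.

Lemma Zdual_diag j : is_diag_mx (Zdual C n j).
Proof. exact: diag_mx_is_diag. Qed.

Lemma Zdual_diff j x y : Zdual C n j x x - Zdual C n j y y = (x < j)%N%:R - (y < j)%N%:R.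
Proof. by rewrite !mxE !eqxx !mulr1n opprB addrA subrK. Qed.

(** The number of elements of J(w) up to x; the value of Z_w on e_x - e_y is
    height y - height x. *)
Definition height w x := (\sum_(1 <= j < n.+1 | `[< J_w C i w j >]) (j <= x))%N.

Lemma Z_w_diag w : is_diag_mx (Z_w C i w).
Proof.
apply/is_diag_mxP => s t st; rewrite /Z_w summxE big1 // => j _.
by have /is_diag_mxP -> := Zdual_diag j.
Qed.

Lemma Z_w_diff w x y :
  Z_w C i w x x - Z_w C i w y y = (height w y)%:R - (height w x)%:R.
Proof.
rewrite /Z_w !summxE -sumrB /height !natr_sum -sumrB; apply: eq_bigr => j _.
rewrite Zdual_diff !ltnNge.
by case: (j <= x)%N; case: (j <= y)%N; rewrite /= ?subrr ?subr0 ?sub0r.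
Qed.

Lemma intr_natB (a b : nat) (k : int) :
  (a%:R - b%:R = k%:~R :> C) <-> a%:Z - b%:Z = k.
Proof.
rewrite -[a%:R]/(a%:Z%:~R) -[b%:R]/(b%:Z%:~R) -rmorphB /=.
by split=> [/intr_inj//|->].
Qed.

Lemma Delta_gradeP k x y : x != y ->
  Delta (@grade C n i k) (rt x y) <-> ((x < i)%N%:Z - (y < i)%N%:Z = k).
Proof.
move=> xy; rewrite -intr_natB -Zdual_diff -root_space_ad //; last exact: Zdual_diag.
by split=> [[]//|sub]; split=> //; rewrite rt_roots.
Qed.

Lemma Delta_grade1P x y : x != y ->
  Delta (@grade C n i 1) (rt x y) <-> (x < i <= y)%N.
Proof.
move=> xy; rewrite Delta_gradeP // [(i <= y)%N]leqNgt.
by case: (x < i)%N; case: (y < i)%N; split=> // /eqP.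
Qed.

Lemma Delta_bigradeP w k l x y :
  Delta (@bigrade C n i w k l) (rt x y) <->
  [/\ x != y, (x < i)%N%:Z - (y < i)%N%:Z = k & (height w y)%:Z - (height w x)%:Z = l].
Proof.
have sub : x != y -> (root_space (rt x y) `<=` @bigrade C n i w k l)%classic <->
    Zdual C n i x x - Zdual C n i y y = k%:~R /\ Z_w C i w x x - Z_w C i w y y = l%:~R.
  move=> xy; rewrite -!root_space_ad ?Zdual_diag ?Z_w_diag //.
  split=> [sub|[s1 s2] A rA]; last by split; [apply: s1|apply: (s2 A rA).2].
  by split=> A rA; have [[slA gA] zA] := sub A rA; split.
rewrite /Delta /=; split=> [[]|[xy gxy zxy]].
  rewrite rt_roots => xy; rewrite (sub xy) Zdual_diff Z_w_diff.
  by rewrite !intr_natB => -[].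
rewrite rt_roots; split=> //.
by rewrite (sub xy) Zdual_diff Z_w_diff !intr_natB.
Qed.

Lemma is_a_wP w a : is_a_w C i w a -> grassmannian i w -> forall x y,
  ((x, y) \in inv_set w) = (x < i <= y)%N && (height w y <= height w x + a)%N.
Proof.
move=> /seteqP[sub1 sub2] gw x y.
have leE : (weight_eval (rt x y) (Z_w C i w) <= a%:R) = (height w y <= height w x + a)%N.
  by rewrite weight_eval_rt Z_w_diff lerBlDl -natrD ler_nat.
apply/idP/andP => [xyw|[xi hxy]].
  have xi := grassmannian_inv_set gw xyw; split=> //.
  have [] := sub1 (rt x y); first by rewrite /= inversionsE.
  by rewrite leE.
rewrite -inversionsE; apply: sub2; split; last by rewrite leE.
by apply/Delta_grade1P => //; rewrite -val_eqE /=; apply/eqP; lia.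
Qed.

(** A matrix lies in n_w when its nonzero entries are at the transposes of the
    inversions. *)
Lemma nil_wP w (N : 'M[C]_n.+1) :
  nil_w w N <-> forall s t, N s t != 0 -> (t, s) \in inv_set w.
Proof.
split=> [[F [HF ->]] s t|HN].
  rewrite summxE; apply: contraR => nts; rewrite big_seq big1 // => al al_w.
  have [x [y [E xyw]]] := inversions_rt al_w.
  have nxy : x != y.
    by move: xyw; rewrite inE /= => /andP[xy _]; rewrite -val_eqE (ltn_eqF xy).
  have := HF al al_w; rewrite E rt_oppr => /root_spaceP[]; first by rewrite eq_sym.
  move=> c ->; rewrite !mxE; case: eqP => [sy|_]; last by rewrite /= mulr0.
  case: eqP => [tx|_]; last by rewrite /= mulr0.
  by rewrite sy tx xyw in nts.
pose F al : 'M[C]_n.+1 := \matrix_(s, t) (if al == rt t s then N s t else 0).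
exists F; split.
  move=> al /inversions_rt[x [y [-> xyw]]]; rewrite rt_oppr.
  have nxy : x != y.
    by move: xyw; rewrite inE /= => /andP[xy _]; rewrite -val_eqE (ltn_eqF xy).
  apply/root_spaceP; first by rewrite eq_sym.
  exists (N y x); apply/matrixP => s t; rewrite !mxE rt_eq // xpair_eqE.
  rewrite [x == t]eq_sym [y == s]eq_sym andbC.
  by case: eqP => [->|_]; case: eqP => [->|_]; rewrite /= ?mulr1 ?mulr0.
apply/matrixP => s t; rewrite summxE.
have [N0|N0] := eqVneq (N s t) 0.
  by rewrite N0 big1 // => al _; rewrite mxE N0; case: eqP.
have tsw := HN _ _ N0.
rewrite (bigD1_seq (rt t s)) ?inversions_uniq ?inversionsE //= big1 ?addr0.
  by rewrite mxE eqxx.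
by move=> al /negPf nal; rewrite mxE nal.
Qed.

(** The root space of -alpha_j moves the boxes of row j to row j-1 if j < i, and
    those of column j-1 to column j if j > i.  It stabilizes n_w when no box
    leaves the diagram in this way. *)
Lemma J_w_corner w (j : nat) : (i <= n)%N -> grassmannian i w -> J_w C i w j ->
  (j < i)%N /\ (exists y, (inord j, y) \in inv_set w /\ (inord j.-1, y) \notin inv_set w) \/
  (i < j)%N /\ (exists x, (x, inord j.-1) \in inv_set w /\ (x, inord j) \notin inv_set w).
Proof.
move=> le_in gw [/andP[j0 jn] ji nsub]; apply: contrapT => nex; apply: nsub.
have jE : (inord j : ord) = j :> nat by rewrite inordK.
have j1E : (inord j.-1 : ord) = j.-1 :> nat by rewrite inordK // (leq_ltn_trans (leq_pred j)).
have neq : inord j != inord j.-1 :> ord by rewrite -val_eqE /= jE j1E; lia.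
move=> A; rewrite /simple_root rt_oppr => rA; split.
  suff : (root_space (rt (inord j) (inord j.-1)) `<=` @grade C n i 0)%classic by apply.
  have [] // := (Delta_gradeP 0 neq).2 _; rewrite jE j1E.
  by move: ji j0; case: j {jn nex jE j1E neq A rA} => // j ji _ /=; case: ltngtP ji.
have /root_spaceP[//|c AE] := rA => N /nil_wP HN; apply/nil_wP => s t.
have E1 : (A *m N) s t = (s == inord j)%:R * (c * N (inord j.-1) t).
  rewrite AE -scalemxAl mxE mxE (bigD1 (inord j.-1)) //= big1 => [|u uj]; rewrite mxE.
    by rewrite eqxx andbT addr0; case: eqP => _; rewrite ?mul1r ?mul0r ?mulr0.
  by rewrite (negPf uj) andbF mul0r.
have E2 : (N *m A) s t = (t == inord j.-1)%:R * (c * N s (inord j)).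
  rewrite AE -scalemxAr mxE mxE (bigD1 (inord j)) //= big1 => [|u uj]; rewrite mxE.
    by rewrite eqxx addr0; case: eqP => _; rewrite ?mul1r ?mul0r ?mulr0 ?mulr1.
  by rewrite (negPf uj) mulr0.
rewrite /lie mxE [X in _ + X]mxE E1 E2; case: (ltngtP j i) => [lji|lij|/ji//].
  have -> : N (inord j.-1) t = 0.
    apply/eqP/negPn/negP => /HN/(grassmannian_inv_set gw) /andP[_]; rewrite j1E; lia.
  rewrite !mulr0 sub0r oppr_eq0; have [->|_] := eqVneq t (inord j.-1); last by rewrite mul0r eqxx.
  rewrite mul1r mulf_eq0 negb_or => /andP[_ /HN sj].
  apply: contrapT => nsj; apply: nex; left; split=> //.
  by exists s; split=> //; apply/negP.
have -> : N s (inord j) = 0.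
  apply/eqP/negPn/negP => /HN/(grassmannian_inv_set gw) /andP[]; rewrite jE; lia.
rewrite !mulr0 subr0; have [->|_] := eqVneq s (inord j); last by rewrite mul0r eqxx.
rewrite mul1r mulf_eq0 negb_or => /andP[_ /HN sj].
apply: contrapT => nsj; apply: nex; right; split=> //.
by exists t; split=> //; apply/negP.
Qed.

End RootData.

(** The row lengths after removal of a hook with one box in each arm: its row x0
    loses two boxes and the row x0 - 1 loses one.  Here r, r0 and r1 are the
    positions w^-1 of the rows x, x0 and x0 - 1. *)
Lemma thin_hook_rows (i x y x0 y0 r r0 r1 : nat) : (0 < x0)%N -> (i <= y0)%N ->
  (r0 + i = x0 + y0 + 2)%N -> (r1 + i = x0 + y0)%N ->
  (x = x0 -> r = r0) -> (x = x0.-1 -> r = r1) ->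
  (y + x < i + (if x == x0 then r0.-2 else if x == x0.-1 then r1.-1 else r))%N =
  (y + x < i + r)%N &&
  ~~ ((x == x0) && ((y == y0) || (y == y0.+1)) || (x == x0.-1) && (y == y0)).
Proof.
move=> x0_gt0 iy0 E0 E1 H0 H1.
case: eqP => [xx0|_]; first by rewrite (H0 xx0); lia.
by case: eqP => [xx1|_] /=; [rewrite (H1 xx1); lia|rewrite andbT].
Qed.

(** * The staircase of blocks *)

Section Blocks.
Variables (C : numFieldType) (n i : nat) (w : 'S_n.+1) (a p q : nat) (j k : nat -> nat).
Hypotheses (hi : (0 < i <= n)%N) (gw : grassmannian i w) (ha : is_a_w C i w a).
Hypothesis hJ : enumerates n i (J_w C i w) p q j k.
Local Notation ord := 'I_n.+1.
Local Notation rt x y := (eps x - eps y : weight n).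
Local Notation h := (height C i w).
Implicit Types x y : ord.

Lemma j_anti l l' : (l < l')%N -> (l' <= p.+1)%N -> (j l' < j l)%N.
Proof.
have [_ _ jd _ _] := hJ.
elim: l' => // l' IH; rewrite ltnS leq_eqVlt => /orP[/eqP->|ll'] l'p; first exact: jd.
exact: ltn_trans (jd l' l'p) (IH ll' (ltnW l'p)).
Qed.

Lemma k_mono m m' : (m < m')%N -> (m' <= q.+1)%N -> (k m < k m')%N.
Proof.
have [_ _ _ kd _] := hJ.
elim: m' => // m' IH; rewrite ltnS leq_eqVlt => /orP[/eqP->|mm'] m'q; first exact: kd.
exact: ltn_trans (IH mm' (ltnW m'q)) (kd m' m'q).
Qed.

Lemma j_leq l l' : (l <= l')%N -> (l' <= p.+1)%N -> (j l' <= j l)%N.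
Proof. by rewrite leq_eqVlt => /orP[/eqP->//|ll' /(j_anti ll')/ltnW]. Qed.

Lemma k_leq m m' : (m <= m')%N -> (m' <= q.+1)%N -> (k m <= k m')%N.
Proof. by rewrite leq_eqVlt => /orP[/eqP->//|mm' /(k_mono mm')/ltnW]. Qed.

Lemma j_first : j 0 = i. Proof. by case: hJ => -[]. Qed.
Lemma k_first : k 0 = i. Proof. by case: hJ => -[]. Qed.
Lemma j_last : j p.+1 = 0%N. Proof. by case: hJ => _ []. Qed.
Lemma k_last : k q.+1 = n.+1. Proof. by case: hJ => _ []. Qed.

Lemma row_block (x : nat) : (x < i)%N -> exists2 l, (l <= p)%N & (j l.+1 <= x < j l)%N.
Proof.
move=> xi; suff H m : (m <= p)%N -> (j m.+1 <= x)%N ->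
    exists2 l, (l <= p)%N & (j l.+1 <= x < j l)%N by apply: (H p); rewrite ?j_last.
elim: m => [|m IH] mp jx; first by exists 0%N; rewrite // jx j_first.
case: (leqP (j m.+1) x) => jx'; first exact: IH (ltnW mp) jx'.
by exists m.+1; rewrite // jx.
Qed.

Lemma column_block (y : nat) : (i <= y <= n)%N ->
  exists2 m, (m <= q)%N & (k m <= y < k m.+1)%N.
Proof.
move=> /andP[iy yn]; suff H m : (m <= q)%N -> (y < k m.+1)%N ->
    exists2 l, (l <= q)%N & (k l <= y < k l.+1)%N by apply: (H q); rewrite ?k_last ?ltnS.
elim: m => [|m IH] mq yk; first by exists 0%N; rewrite // yk k_first iy.
case: (ltnP y (k m.+1)) => yk'; first exact: IH (ltnW mq) yk'.
by exists m.+1; rewrite // yk yk'.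
Qed.

(** The enumeration turns the sum over J(w) into sums over its two halves. *)
Lemma height_enumerated x :
  h x = (\sum_(1 <= l < p.+1) (j l <= x) + \sum_(1 <= m < q.+1) (k m <= x))%N.
Proof.
have [_ _ _ _ JE] := hJ.
pose r := [seq j l | l <- index_iota 1 p.+1] ++ [seq k m | m <- index_iota 1 q.+1].
have jin l : l \in index_iota 1 p.+1 -> (0 < j l < i)%N.
  rewrite mem_index_iota => /andP[l0 lp].
  by rewrite -[X in (_ < _ < X)%N]j_first (j_anti l0 (ltnW lp)) andbT -[X in (X < _)%N]j_last j_anti.
have kin m : m \in index_iota 1 q.+1 -> (i < k m < n.+1)%N.
  rewrite mem_index_iota => /andP[m0 mq].
  by rewrite -[X in (X < _ < _)%N]k_first (k_mono m0 (ltnW mq)) /= -[X in (_ < X)%N]k_last k_mono.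
have kinj : {in index_iota 1 q.+1 &, injective k}.
  move=> m m'; rewrite !mem_index_iota => /andP[_ mq] /andP[_ mq'] E.
  case: (ltngtP m m') => // mm.
    by have := k_mono mm (ltnW mq'); rewrite E ltnn.
  by have := k_mono mm (ltnW mq); rewrite E ltnn.
have jinj : {in index_iota 1 p.+1 &, injective j}.
  move=> m m'; rewrite !mem_index_iota => /andP[_ mq] /andP[_ mq'] E.
  case: (ltngtP m m') => // mm.
    by have := j_anti mm (ltnW mq'); rewrite E ltnn.
  by have := j_anti mm (ltnW mq); rewrite E ltnn.
have perm : perm_eq r [seq t <- index_iota 1 n.+1 | `[< J_w C i w t >]].
  apply: uniq_perm.
  - rewrite cat_uniq (map_inj_in_uniq jinj) (map_inj_in_uniq kinj) !iota_uniq andbT /=.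
    apply/hasPn => t /mapP[u /kin/andP[ik _] tE]; apply/mapP => -[l /jin/andP[_ ji] E].
    by rewrite -tE E ltnNge (ltnW ji) in ik.
  - by rewrite filter_uniq // iota_uniq.
  move=> t; rewrite mem_cat mem_filter; apply/idP/andP.
    case/orP => /mapP[l lr ->].
      have /andP[jl0 jli] := jin l lr; move: lr; rewrite mem_index_iota ltnS => lr.
      split; first by apply/asboolP; rewrite JE; left; exists l.
      by rewrite mem_index_iota jl0; lia.
    have /andP[kl0 kli] := kin l lr; move: lr; rewrite mem_index_iota ltnS => lr.
    split; first by apply/asboolP; rewrite JE; right; exists l.
    by rewrite mem_index_iota kli; lia.
  case=> /asboolP; rewrite JE => -[[l lr ->]|[l lr ->]] _; apply/orP; [left|right].
    by apply/mapP; exists l; rewrite // mem_index_iota ltnS.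
  by apply/mapP; exists l; rewrite // mem_index_iota ltnS.
rewrite /height -big_filter -(perm_big _ perm) /r big_cat /= !big_map //.
Qed.

Lemma height_row x l : (l <= p)%N -> (j l.+1 <= x < j l)%N -> h x = (p - l)%N.
Proof.
move=> lp /andP[jx xj]; rewrite height_enumerated.
have xi : (x < i)%N by rewrite (leq_trans xj) // -j_first j_leq // (leq_trans lp).
rewrite [X in (_ + X)%N]big_nat_cond [X in (_ + X)%N]big1 ?addn0; last first.
  move=> m /andP[/andP[m0 mq] _]; apply/eqP; rewrite eqb0 -ltnNge (ltn_trans xi) //.
  by rewrite -k_first k_mono // ltnW.
transitivity (\sum_(1 <= l' < p.+1) (l < l'))%N.
  apply: eq_big_nat => l' /andP[l'0 l'p]; congr nat_of_bool.
  case: (ltnP l l') => ll; last first.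
    by apply/negbTE; rewrite -ltnNge (leq_trans xj) // j_leq // ltnW.
  by rewrite (leq_trans _ jx) // j_leq // ltnW.
elim: p lp => [|r IH] lr; first by rewrite big_nil sub0n.
rewrite big_nat_recr //=; case: (leqP l r) => lr'.
  by rewrite IH // ltnS lr'; lia.
rewrite ltnS leqNgt lr' addn0 big_nat_cond big1; first by lia.
by move=> l' /andP[/andP[_ l'r] _]; apply/eqP; rewrite eqb0; lia.
Qed.

Lemma height_column y m : (m <= q)%N -> (k m <= y < k m.+1)%N -> h y = (p + m)%N.
Proof.
move=> mq /andP[ky yk]; rewrite height_enumerated.
have iy : (i <= y)%N by rewrite (leq_trans _ ky) // -k_first k_leq // (leq_trans mq).
congr (_ + _)%N.
  transitivity (\sum_(1 <= l' < p.+1) 1)%N; last by rewrite sum_nat_const_nat muln1 subSS subn0.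
  apply: eq_big_nat => l' /andP[l'0 l'p].
  by rewrite (leq_trans _ iy) // -j_first j_leq // ltnW.
transitivity (\sum_(1 <= m' < q.+1) (m' <= m))%N.
  apply: eq_big_nat => m' /andP[m'0 m'q]; congr nat_of_bool.
  case: (leqP m' m) => mm; first by rewrite (leq_trans _ ky) // k_leq // (leq_trans mq).
  by apply/negbTE; rewrite -ltnNge (leq_trans yk) // k_leq // ltnW.
elim: q mq => [|r IH] mr; first by rewrite big_nil; lia.
rewrite big_nat_recr //=; case: (leqP m r) => mr'.
  by rewrite IH // addn0.
have -> : m = r.+1 by lia.
rewrite big_nat_cond (eq_bigr (fun=> 1%N)) -?big_nat_cond.
  by rewrite sum_nat_const_nat muln1; lia.
by move=> m' /andP[/andP[_ m'r] _]; rewrite ltnW.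
Qed.

Definition inv_set_heightE := is_a_wP ha gw.

Lemma inord_val_lt (t : nat) : (t <= n)%N -> (inord t : ord) = t :> nat.
Proof. by move=> tn; rewrite inordK. Qed.

(** The corner at j_1 is a column y whose box in row j_1 belongs to the diagram
    while its box in row j_1 - 1 does not; comparing heights, y lies in the
    block of columns number a. *)
Lemma a_leq_q : (0 < p)%N -> (a <= q)%N.
Proof.
move=> p0; have [_ _ _ _ JE] := hJ.
have /andP[i0 le_in] := hi.
have j1i : (j 1 < i)%N by rewrite -j_first j_anti.
have : J_w C i w (j 1) by rewrite JE; left; exists 1%N; rewrite ?p0.
case/(J_w_corner le_in gw) => [[_ [y []]]|[]]; last by rewrite ltnNge (ltnW j1i).
have j1n : (j 1 <= n)%N by lia.
have j1E := inord_val_lt j1n.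
have j1E' : (inord (j 1).-1 : ord) = (j 1).-1 :> nat by rewrite inord_val_lt; lia.
have j21 : (j 2 < j 1)%N by rewrite j_anti.
rewrite !inv_set_heightE => /andP[/andP[_ iy] h1].
rewrite iy andbT negb_and -leqNgt -ltnNge => /orP[|h2]; first by rewrite j1E'; lia.
have [|m mq ym] := @column_block y; first by rewrite iy -ltnS ltn_ord.
have hx : h (inord (j 1)) = (p - 0)%N by apply: height_row; rewrite // j1E leqnn j_first.
have hx' : h (inord (j 1).-1) = (p - 1)%N by apply: height_row; rewrite // j1E'; lia.
rewrite (height_column mq ym) hx in h1; rewrite (height_column mq ym) hx' in h2.
lia.
Qed.

Lemma a_leq_p : (0 < q)%N -> (a <= p)%N.
Proof.
move=> q0; have [_ _ _ _ JE] := hJ.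
have /andP[i0 le_in] := hi.
have k1i : (i < k 1)%N by rewrite -k_first k_mono.
have k1n : (k 1 <= n)%N by rewrite -ltnS -k_last k_mono.
have : J_w C i w (k 1) by rewrite JE; right; exists 1%N; rewrite ?q0.
case/(J_w_corner le_in gw) => [[]|[_ [x []]]]; first by rewrite ltnNge (ltnW k1i).
have k1E := inord_val_lt k1n.
have k1E' : (inord (k 1).-1 : ord) = (k 1).-1 :> nat by rewrite inord_val_lt; lia.
have k12 : (k 1 < k 2)%N by rewrite k_mono.
rewrite !inv_set_heightE => /andP[/andP[xi _] h1].
rewrite xi /= negb_and -!ltnNge => /orP[|h2]; first by rewrite k1E; lia.
have [l lp xl] := row_block xi.
have hy : h (inord (k 1)) = (p + 1)%N by apply: height_column; rewrite // k1E leqnn.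
have hy' : h (inord (k 1).-1) = (p + 0)%N by apply: height_column; rewrite // k1E' k_first; lia.
rewrite (height_row lp xl) hy' in h1; rewrite (height_row lp xl) hy in h2.
lia.
Qed.

(** If J(w) is empty, Z_w = 0 and Delta(w) contains all boxes. *)
Lemma J_nonempty : ~ longest_min_rep i w -> (0 < p)%N || (0 < q)%N.
Proof.
have /andP[_ le_in] := hi.
move=> nl; apply: contraT; rewrite negb_or -!eqn0Ngt => /andP[/eqP p0 /eqP q0]; case: nl.
split=> [|v /(min_repP v le_in) gv]; first exact/min_repP.
rewrite !weyl_lengthE; apply/subset_leq_card/fintype.subsetP => -[x y].
move=> /(grassmannian_inv_set gv) xy.
rewrite inv_set_heightE xy /=; have /andP[xi iy] := xy.
have [l lp xl] := row_block xi.
have [|m mq ym] := @column_block y; first by rewrite iy -ltnS ltn_ord.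
rewrite (height_row lp xl) (height_column mq ym); lia.
Qed.

Lemma sum_simple_roots (s t : nat) : (s < t)%N ->
  \sum_(s.+1 <= u < t) simple_root n u = rt (inord s) (inord t.-1).
Proof.
elim: t => // t IH; rewrite ltnS leq_eqVlt => /orP[/eqP->|st].
  by rewrite big_geq //= subrr.
rewrite big_nat_recr //= IH // /simple_root addrA subrK //.
Qed.

(** If the box were not extreme in its block, adding the root that moves it by
    one row or one column inside the block would give a root. *)
Lemma Pi_w_corner e : ~ longest_min_rep i w -> Pi_w C i w a e ->
  exists L M x y, [/\ (0 < L <= p)%N, (0 < M <= q)%N, (L + M = a + 1)%N,
    x = j L :> nat /\ y = (k M).-1 :> nat & e = rt x y].
Proof.
move=> nl [] [e_root sub_e] maxe.
have /rootsP[x [y [xy eE]]] := e_root; subst e.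
have De : Delta (@bigrade C n i w 1 (a%:Z - 1)) (rt x y) by split.
have := De; rewrite Delta_bigradeP => -[_ gxy hxy].
have /andP[xi iy] : (x < i <= y)%N.
  by move: gxy; rewrite [(i <= y)%N]leqNgt; case: (x < i)%N; case: (y < i)%N => // /eqP.
have [l lp xl] := row_block xi.
have yn : (i <= y <= n)%N by rewrite iy -ltnS ltn_ord.
have [m mq ym] := column_block yn.
have hx := height_row lp xl; have hy := height_column mq ym.
have lm : (l + m + 1 = a)%N by rewrite hx hy in hxy; lia.
have /orP pq := J_nonempty nl.
have ap : (a <= p)%N.
  case: (posnP q) => [q0|]; last exact: a_leq_p.
  by case: pq => [/a_leq_q|]; lia.
have aq : (a <= q)%N.
  case: (posnP p) => [p0|]; last exact: a_leq_q.
  by lia.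
have le_in : (i <= n)%N by case/andP: hi.
have xE : x = j l.+1 :> nat.
  apply/eqP/negPn/negP => xj.
  have xj' : (j l.+1 < x)%N.
    by case/andP: xl => jx _; rewrite ltn_neqAle eq_sym xj.
  pose x' : ord := inord x.-1.
  have x1E : x' = x.-1 :> nat by rewrite inord_val_lt //; have := ltn_ord x; lia.
  have hx1 : h x' = (p - l)%N by apply: height_row => //; rewrite x1E; case/andP: xl; lia.
  have D0 : Delta (@bigrade C n i w 0 0) (rt x' x).
    rewrite Delta_bigradeP.
    split; [by rewrite -val_eqE /= x1E; lia| |by rewrite hx hx1 subrr].
    have -> : (x' < i)%N by rewrite x1E; lia.
    by rewrite xi subrr.
  have := maxe _ D0; rewrite rt_pos_roots addrC addrA subrK rt_roots x1E.
  have -> : x' != y by rewrite -val_eqE /= x1E; lia.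
  by move=> /(_ _)/negP; apply=> //; lia.
have yE : y = (k m.+1).-1 :> nat.
  apply/eqP/negPn/negP => yk.
  have yk' : (y.+1 < k m.+1)%N by case/andP: ym => _ yk'; lia.
  pose y' : ord := inord y.+1.
  have kn : (k m.+1 <= n.+1)%N by rewrite -k_last k_leq.
  have y1E : y' = y.+1 :> nat by rewrite inord_val_lt //; lia.
  have hy1 : h y' = (p + m)%N by apply: height_column => //; rewrite y1E; case/andP: ym; lia.
  have D0 : Delta (@bigrade C n i w 0 0) (rt y y').
    rewrite Delta_bigradeP.
    split; [by rewrite -val_eqE /= y1E; lia| |by rewrite hy hy1 subrr].
    have -> : (y' < i)%N = false by rewrite y1E; lia.
    by rewrite ltnNge iy subrr.
  have := maxe _ D0; rewrite rt_pos_roots addrA subrK rt_roots y1E.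
  have -> : x != y' by rewrite -val_eqE /= y1E; lia.
  by move=> /(_ _)/negP; apply=> //; lia.
exists l.+1, m.+1, x, y; split=> //; lia.
Qed.

(** * The hook at a corner *)

Definition hook x0 y0 (L M : nat) : {set ord * ord} :=
  (x0, y0) |: [set (x, y0) | x in [set x : ord | (j L.+1 <= x < j L)%N]]
    :|: [set (x0, y) | y in [set y : ord | (k M <= y < k M.+1)%N]].

Lemma card_hook x0 y0 L M : (L <= p)%N -> (0 < M <= q)%N ->
  x0 = j L :> nat -> y0 = (k M).-1 :> nat ->
  #|hook x0 y0 L M| = (1 + (j L - j L.+1) + (k M.+1 - k M))%N.
Proof.
move=> Lp /andP[M0 Mq] xE yE.
have kM : (0 < k M)%N by rewrite (leq_ltn_trans _ (k_mono M0 (ltnW _))) // ltnS.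
have jn : (j L <= n.+1)%N.
  by rewrite (leq_trans (j_leq (leq0n L) (leqW Lp))) // j_first; case/andP: hi; lia.
have kn : (k M.+1 <= n.+1)%N by rewrite -k_last k_leq.
rewrite /hook cardsU [X in (_ - X)%N](_ : _ = 0%N); last first.
  apply/eqP; rewrite cards_eq0 -finset.subset0; apply/fintype.subsetP => z.
  rewrite !inE => /andP[H /imsetP[y]]; rewrite inE => yM zE; move: H; rewrite zE.
  rewrite xpair_eqE eqxx /= -val_eqE /= yE => /orP[|/imsetP[x _ [_ E]]]; first by lia.
  by move: yM; rewrite E yE; lia.
rewrite subn0 cardsU1 [X in (~~ X)](_ : _ = false); last first.
  apply/imsetP => -[x]; rewrite inE => xL [E]; move: xL; rewrite -E xE; lia.
rewrite !card_imset; last by move=> ? ? [].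
  by rewrite !card_interval.
by move=> ? ? [].
Qed.

Section Corner.
Variables (L M : nat) (x0 y0 : ord).
Hypotheses (L_p : (0 < L <= p)%N) (M_q : (0 < M <= q)%N) (LM : (L + M = a + 1)%N).
Hypotheses (x0E : x0 = j L :> nat) (y0E : y0 = (k M).-1 :> nat).

Lemma corner_le_in : (i <= n)%N. Proof. by case/andP: hi. Qed.

Lemma corner_row : (j L.+1 < x0 < i)%N && (x0 < j L.-1)%N.
Proof.
have /andP[L0 Lp] := L_p; rewrite x0E j_anti //= -j_first !j_anti //; lia.
Qed.

Lemma corner_column : [/\ (i <= y0)%N, y0.+1 = k M, (k M.-1 <= y0)%N & (k M <= n)%N].
Proof.
have /andP[M0 Mq] := M_q; have kM : (i < k M)%N by rewrite -k_first k_mono // ltnW.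
have kM' : (k M.-1 < k M)%N by rewrite k_mono //; lia.
have kn : (k M < n.+1)%N by rewrite -k_last k_mono.
by rewrite y0E; split; lia.
Qed.

Lemma height_x0 : h x0 = (p - L.-1)%N.
Proof.
have /andP[L0 Lp] := L_p; apply: height_row; first by lia.
by rewrite prednK // x0E leqnn -x0E; case/andP: corner_row.
Qed.

Lemma height_y0 : h y0 = (p + M.-1)%N.
Proof.
have /andP[M0 Mq] := M_q; have [_ y1 ky _] := corner_column.
by apply: height_column; [lia|rewrite prednK // ky -y1 /=].
Qed.

Lemma height_before x : (x < j L)%N -> (h x <= p - L)%N.
Proof.
move=> xL; have /andP[L0 Lp] := L_p.
have xi : (x < i)%N by rewrite (leq_trans xL) // -j_first j_leq // leqW.
have [l lp /andP[xl1 xl2]] := row_block xi.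
rewrite (height_row lp) ?xl1 ?xl2 //; apply: leq_sub2l; rewrite leqNgt; apply/negP => lL.
by have := leq_trans xL (leq_trans (j_leq lL (leqW Lp)) xl1); rewrite ltnn.
Qed.

Lemma height_after y : (k M <= y)%N -> (p + M <= h y)%N.
Proof.
move=> yM; have /andP[M0 Mq] := M_q.
have iy : (i <= y)%N by rewrite (leq_trans _ yM) // -k_first k_leq // leqW.
have [|m mq /andP[ym1 ym2]] := @column_block y; first by rewrite iy -ltnS ltn_ord.
rewrite (height_column mq) ?ym1 ?ym2 // leq_add2l leqNgt; apply/negP => mM.
by have := leq_trans ym2 (leq_trans (k_leq mM (leqW Mq)) yM); rewrite ltnn.
Qed.

Lemma row_of_height x l : (x < i)%N -> (l <= p)%N -> h x = (p - l)%N -> (j l.+1 <= x < j l)%N.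
Proof.
move=> xi lp; have [l' lp' xl'] := row_block xi.
by rewrite (height_row lp' xl') => E; have <- : l' = l by lia.
Qed.

Lemma column_of_height y m : (i <= y)%N -> h y = (p + m)%N -> (k m <= y < k m.+1)%N.
Proof.
move=> iy; have [|m' mq' ym'] := @column_block y; first by rewrite iy -ltnS ltn_ord.
by rewrite (height_column mq' ym') => E; have <- : m' = m by lia.
Qed.

Lemma hookP x y : (x, y) \in hook x0 y0 L M <->
  [\/ x = x0 /\ y = y0, (j L.+1 <= x < j L)%N /\ y = y0 | x = x0 /\ (k M <= y < k M.+1)%N].
Proof.
rewrite !inE; split.
  case/orP => [/orP[/eqP[-> ->]|/imsetP[x']]|/imsetP[y']]; first by constructor 1.
    by rewrite inE => xL [-> ->]; constructor 2.
  by rewrite inE => yM [-> ->]; constructor 3.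
case=> [[-> ->]|[xL ->]|[-> yM]]; first by rewrite eqxx.
  by rewrite imset_f ?orbT ?inE.
by rewrite [X in _ || X]imset_f ?orbT ?inE.
Qed.

Lemma hook_inv : hook x0 y0 L M \subset inv_set w.
Proof.
have /andP[L0 Lp] := L_p; have /andP[M0 Mq] := M_q.
have /andP[/andP[jx xi] _] := corner_row; have [iy y1 _ kn] := corner_column.
apply/fintype.subsetP => -[x y] /hookP[[-> ->]|[xL ->]|[-> yM]].
- by rewrite inv_set_heightE xi iy height_x0 height_y0; lia.
- have xi' : (x < i)%N by lia.
  by rewrite inv_set_heightE xi' iy (height_row Lp xL) height_y0; lia.
- have iy' : (i <= y)%N by lia.
  by rewrite inv_set_heightE xi iy' height_x0 (height_column Mq yM); lia.
Qed.

(** For a box nu different from eps, nu - eps is a root only if both are in the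
    same row or in the same column; the two degree conditions then place nu in
    the next block. *)
Lemma Delta_w_epsP x y : (x < i <= y)%N ->
  Delta_w_eps C i w a (rt x0 y0) (rt x y) <-> (x, y) \in hook x0 y0 L M.
Proof.
move=> /andP[xi iy]; have /andP[L0 Lp] := L_p; have /andP[M0 Mq] := M_q.
have /andP[/andP[jx x0i] _] := corner_row; have [iy0 y1 _ kn] := corner_column.
have nxy : x != y by rewrite -val_eqE /=; lia.
have nxy0 : x0 != y0 by rewrite -val_eqE /=; lia.
have hx0 := height_x0; have hy0 := height_y0.
have Ex z : rt z y0 - rt x0 y0 = rt z x0 by rewrite opprB addrA subrK.
have Ey z : rt x0 z - rt x0 y0 = rt y0 z.
  by rewrite opprB addrC -addrA [X in _ + X]addrA addNr add0r.
rewrite hookP; split.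
  case=> [/(rt_inj nxy)[-> ->]|[]]; first by constructor 1.
  rewrite Delta_bigradeP => -[_ _ hxy].
  have [->|ny] := eqVneq y y0.
    rewrite Ex Delta_bigradeP => -[_ _ hd]; constructor 2; split=> //.
    by apply: row_of_height => //; lia.
  have [->|nx] := eqVneq x x0.
    rewrite Ey Delta_bigradeP => -[_ _ hd]; constructor 3; split=> //.
    by apply: column_of_height => //; lia.
  case=> rootD _; by have := rt_sub_notin nxy nxy0 nx ny; rewrite rootD.
case=> [[-> ->]|[xL ->]|[-> yM]]; first by left.
  right; split; rewrite /= ?Ex Delta_bigradeP; split.
  - by rewrite -val_eqE /=; lia.
  - by rewrite xi ltnNge iy0.
  - by rewrite hy0 (height_row Lp xL); lia.
  - by rewrite -val_eqE /=; lia.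
  - by rewrite xi x0i subrr.
  - by rewrite hx0 (height_row Lp xL); lia.
right; split; rewrite /= ?Ey Delta_bigradeP; split.
- by rewrite -val_eqE /=; lia.
- by rewrite x0i ltnNge iy.
- by rewrite hx0 (height_column Mq yM); lia.
- by rewrite -val_eqE /=; lia.
- by rewrite !ltnNge iy iy0 subrr.
- by rewrite hy0 (height_column Mq yM); lia.
Qed.

Lemma w_eps_codim v : is_w_eps C i w a (rt x0 y0) v ->
  is_codim i (schubert C i v) (schubert C i w) (1 + (j L - j L.+1) + (k M.+1 - k M)).
Proof.
move=> [minv /seteqP[sub1 sub2]]; have le_in := corner_le_in.
have gv : grassmannian i v by apply/min_repP.
have vE x y : ((x, y) \in inv_set v) =
    ((x, y) \in inv_set w) && ((x, y) \notin hook x0 y0 L M).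
  apply/idP/andP => [xyv|[xyw nh]].
    have [] := sub1 (rt x y); first by rewrite /= inversionsE.
    rewrite /= inversionsE => xyw nD; split=> //; apply/negP => xyh; apply: nD.
    by apply/Delta_w_epsP => //; apply: grassmannian_inv_set gw xyw.
  rewrite -inversionsE; apply: sub2; split; first by rewrite /= inversionsE.
  by rewrite (Delta_w_epsP (grassmannian_inv_set gw xyw)); apply/negP.
have /andP[_ Lp] := L_p.
rewrite -(card_hook Lp M_q x0E y0E).
have -> : hook x0 y0 L M = (inv_set w :\: inv_set v)%SET.
  apply/setP => -[x y]; rewrite finset.in_setD vE negb_and negbK andb_orl andNb /=.
  case: (boolP ((x, y) \in hook x0 y0 L M)) => // xyh.
  by rewrite (fintype.subsetP hook_inv _ xyh).
apply: schubert_codim => //; apply/fintype.subsetP => -[x y].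
by rewrite vE => /andP[].
Qed.

(** For a positive root e_s - e_t of degree (0,0), adding it to eps gives a root
    only when t = x0 or s = y0.  Then s would be a row before x0, or t a column
    after y0, of the same height, but x0 begins and y0 ends its block. *)
Lemma Pi_w_of_corner : Pi_w C i w a (rt x0 y0).
Proof.
have /andP[L0 Lp] := L_p; have /andP[M0 Mq] := M_q.
have /andP[/andP[jx x0i] _] := corner_row; have [iy0 y1 _ kn] := corner_column.
have hx0 := height_x0; have hy0 := height_y0.
have nxy0 : x0 != y0 by rewrite -val_eqE /=; lia.
split.
  rewrite Delta_bigradeP; split=> //; first by rewrite x0i ltnNge iy0.
  by rewrite hx0 hy0; lia.
move=> al Dal /pos_rootsP[s [t [st E]]]; move: Dal; rewrite {}E.
rewrite Delta_bigradeP => -[nst gst hst].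
have [tx|tx] := eqVneq t x0.
  have := @height_before s; rewrite -x0E -tx st => /(_ isT).
  by move: hst; rewrite tx hx0; lia.
have [sy|sy] := eqVneq s y0.
  have := @height_after t; rewrite -y1 -sy st => /(_ isT).
  by move: hst; rewrite sy hy0; lia.
by rewrite -(rt_oppr t s) rt_sub_notin // eq_sym.
Qed.

Lemma thin_hookE x y : (j L - j L.+1 = 1)%N -> (k M.+1 - k M = 1)%N ->
  ((x, y) \in hook x0 y0 L M) =
    ((x == x0 :> nat) && ((y == y0 :> nat) || (y == y0.+1 :> nat))) ||
    ((x == x0.-1 :> nat) && (y == y0 :> nat)).
Proof.
move=> gapj gapk; have /andP[/andP[jx x0i] _] := corner_row.
have [iy0 y1 _ kn] := corner_column.
apply/idP/idP => [/hookP[[-> ->]|[xL ->]|[-> yM]]|]; rewrite ?eqxx //=.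
- by apply/orP; right; apply/andP; split=> //; apply/eqP; lia.
- by apply/orP; left; apply/orP; right; apply/eqP; lia.
case/orP => [/andP[/eqP/val_inj-> /orP[/eqP/val_inj->|/eqP yE]]|/andP[/eqP xE /eqP/val_inj->]].
- by apply/hookP; constructor 1.
- by apply/hookP; constructor 3; split=> //; lia.
- by apply/hookP; constructor 2; split=> //; lia.
Qed.

(** When both arms of the hook have length 1, the shape of w_eps is that of w
    with the leading rows of x0 and x0 - 1 lowered by two and one. *)
Lemma w_eps_exists : (j L - j L.+1 = 1)%N -> (k M.+1 - k M = 1)%N ->
  exists v, is_w_eps C i w a (rt x0 y0) v.
Proof.
move=> gapj gapk; have le_in := corner_le_in.
have /andP[L0 Lp] := L_p; have /andP[M0 Mq] := M_q.
have /andP[/andP[jx x0i] _] := corner_row; have [iy0 y1 _ kn] := corner_column.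
have hx0 := height_x0; have hy0 := height_y0.
pose S x : nat := (w^-1)%g x.
have inS x y : (x < i)%N -> (i <= y)%N -> ((x, y) \in inv_set w) = (y + x < i + S x)%N.
  by move=> xi iy; apply: grassmannian_inv_row.
have Sinc x y : (x < y)%N -> (y < i)%N -> (S x < S y)%N.
  by move=> xy yi; apply: gw; rewrite ?yi.
pose x1 : ord := inord x0.-1.
have x1E : x1 = x0.-1 :> nat by rewrite inord_val_lt //; lia.
pose y1o : ord := inord y0.+1.
have y1E : y1o = y0.+1 :> nat by rewrite inord_val_lt //; lia.
have x1i : (x1 < i)%N by lia.
have hx1 : h x1 = (p - L)%N by apply: height_row => //; lia.
have hy1 : h y1o = (p + M)%N by apply: height_column => //; lia.
have kM2 : (k M.+1 <= n.+1)%N by rewrite -k_last k_leq.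
(* The row x0 ends at y0 + 1, and the row x0 - 1 at y0. *)
have Sx0 : (S x0 + i = x0 + y0 + 2)%N.
  have : (x0, y1o) \in inv_set w by rewrite inv_set_heightE x0i hx0 hy1; lia.
  rewrite inS //; last by lia.
  rewrite y1E => lo; have up : (S x0 + i <= x0 + y0 + 2)%N; last by lia.
  case: (ltnP y0.+2 n.+1) => yn; last first.
    by have := grassmannian_row_leq le_in gw x0i; rewrite -/(S x0); lia.
  have : (x0, Ordinal yn) \notin inv_set w.
    rewrite inv_set_heightE negb_and -ltnNge hx0; apply/orP; right.
    have Mq' : (M.+1 <= q)%N.
      rewrite ltn_neqAle Mq andbT; apply/eqP => E; have := k_last; rewrite -E; lia.
    have [|m mq ym] := @column_block (Ordinal yn); first by rewrite /=; lia.
    rewrite (height_column mq ym); suff : (M < m)%N by lia.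
    rewrite ltnNge; apply/negP => mM.
    have := k_leq (_ : m.+1 <= M.+1)%N (leqW Mq' : M.+1 <= q.+1)%N => /(_ mM).
    by case/andP: ym => _ /=; lia.
  by rewrite inS //=; lia.
have Sx1 : (S x1 + i = x0 + y0)%N.
  have : (x1, y0) \in inv_set w by rewrite inv_set_heightE x1i iy0 hx1 hy0; lia.
  have : (x1, y1o) \notin inv_set w.
    by rewrite inv_set_heightE negb_and -ltnNge hx1 hy1; apply/orP; right; lia.
  by rewrite !inS //; lia.
have Sbefore x : (x < x1)%N -> (S x + i <= x + y0)%N.
  move=> xx1; have xi : (x < i)%N by lia.
  have : (x, y0) \notin inv_set w; last by rewrite inS //; lia.
  rewrite inv_set_heightE negb_and -ltnNge hy0; apply/orP; right.
  have [l lp xl] := row_block xi; rewrite (height_row lp xl).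
  suff : (L < l)%N by lia.
  rewrite ltnNge; apply/negP => lL.
  have := j_leq (_ : l.+1 <= L.+1)%N (_ : L.+1 <= p.+1)%N => /(_ lL Lp).
  by case/andP: xl; lia.
pose s (r : 'I_i) : ord := inord (if r == x0 :> nat then (S x0).-2 else
  if r == x1 :> nat then (S x1).-1 else S (widen_ord (leqW le_in) r)).
have Sn x : (S x <= n)%N by rewrite -ltnS; apply: ltn_ord.
have sE r : s r = (if r == x0 :> nat then (S x0).-2 else
  if r == x1 :> nat then (S x1).-1 else S (widen_ord (leqW le_in) r)) :> nat.
  rewrite inord_val_lt //; case: ifP => _.
    by rewrite (leq_trans _ (Sn x0)) // -subn2 leq_subr.
  by case: ifP => _ //; rewrite (leq_trans (leq_pred _) (Sn x1)).
have wideE (r : 'I_i) x : r = x :> nat -> S (widen_ord (leqW le_in) r) = S x.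
  by move=> E; congr S; apply: val_inj.
have sinc : increasing s.
  move=> r r' rr'; rewrite !sE; have ri := ltn_ord r'.
  have Srr : (S (widen_ord (leqW le_in) r) < S (widen_ord (leqW le_in) r'))%N by apply: Sinc.
  have sb := Sbefore (widen_ord (leqW le_in) r); rewrite /= in sb.
  have s0 := wideE r x0; have s0' := wideE r' x0.
  have s1 := wideE r x1; have s1' := wideE r' x1.
  have S01 : (r < x1)%N -> (S (widen_ord (leqW le_in) r) < S x1)%N.
    by move=> ?; apply: Sinc.
  move: Srr sb s0 s0' s1 s1' S01 Sx0 Sx1 x1E rr' jx iy0.
  move: (S (widen_ord _ r)) (S (widen_ord _ r')) (S x0) (S x1) => A B D E.
  by clear; do ?case: eqP => [?|?]; lia.
have [v gv vs] := grassmannian_exists le_in sinc.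
exists v; split; first exact/min_repP.
have vE x y (xi : (x < i)%N) : (i <= y)%N ->
    ((x, y) \in inv_set v) = (y + x < i + s (Ordinal xi))%N.
  move=> iy; rewrite (grassmannian_inv_row le_in gv xi iy) -vs /shape.
  by have -> : widen_ord (leqW le_in) (Ordinal xi) = x by apply: val_inj.
have key x y : ((x, y) \in inv_set v) =
    ((x, y) \in inv_set w) && ((x, y) \notin hook x0 y0 L M).
  case: (boolP (x < i <= y)%N) => [/andP[xi iy]|nxy]; last first.
    apply/idP/andP => [/(grassmannian_inv_set gv)|[/(grassmannian_inv_set gw)]];
      by rewrite (negPf nxy).
  rewrite (vE _ _ xi iy) inS // sE /=.
  have s0 : x = x0 :> nat -> S x = S x0 by move=> /val_inj->.
  have s1 : x = x1 :> nat -> S x = S x1 by move=> /val_inj->.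
  have -> : S (widen_ord (leqW le_in) (Ordinal xi)) = S x by congr S; apply: val_inj.
  rewrite x1E in s1 *; rewrite (thin_hookE _ _ gapj gapk); apply: thin_hook_rows => //.
  exact: leq_ltn_trans jx.
apply/seteqP; split=> al /=.
  move=> /inversions_rt[x [y [-> xyv]]]; rewrite inversionsE.
  have := xyv; rewrite key => /andP[xyw nh]; split=> //.
  by rewrite (Delta_w_epsP (grassmannian_inv_set gw xyw)); apply/negP.
case=> /inversions_rt[x [y [-> xyw]]] nD; rewrite inversionsE key xyw /=.
apply/negP => xyh; apply: nD; apply/Delta_w_epsP => //; exact: grassmannian_inv_set gw xyw.
Qed.

End Corner.

End Blocks.

(** * The codimension of the singular components *)

Lemma is_codim_unique (C : fieldType) n i (Y Y' : set (cspace C n)) c c' :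
  is_codim i Y Y' c -> is_codim i Y Y' c' -> c = c'.
Proof. by move=> [ch1 m1] [ch2 m2]; apply/eqP; rewrite eqn_leq m1 ?m2. Qed.

Theorem corollary3p7 (R : realType) (n i : nat) (hi : (0 < i <= n)%N)
    (w : 'S_n.+1) (hw : min_rep i w) (hw1 : w != 1%g)
    (hw0 : ~ longest_min_rep i w)
    (a : nat) (ha : is_a_w R[i] i w a)
    (p q : nat) (j k : nat -> nat)
    (hJ : enumerates n i (J_w R[i] i w) p q j k) :
  (forall e v, Pi_w R[i] i w a e -> is_w_eps R[i] i w a e v ->
     exists c : nat,
       [/\ is_codim i (schubert R[i] i v) (schubert R[i] i w) c,
           (3 <= c)%N &
           c = 3%N <->
           exists l m : nat,
             [/\ (0 < l <= p)%N, (0 < m <= q)%N, (l + m = a + 1)%N,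
                 (j l - j l.+1 = 1)%N /\ (k m.+1 - k m = 1)%N &
                 e = \sum_((j l).+1 <= t < k m) simple_root n t]]) /\
  ((exists e v, [/\ Pi_w R[i] i w a e, is_w_eps R[i] i w a e v &
      is_codim i (schubert R[i] i v) (schubert R[i] i w) 3]) <->
   exists l m : nat,
     [/\ (0 < l <= p)%N, (0 < m <= q)%N, (l + m = a + 1)%N &
         (j l - j l.+1 = 1)%N /\ (k m.+1 - k m = 1)%N]).
Proof.
have /andP[i0 le_in] := hi.
have gw : grassmannian i w by apply/min_repP.
have sumE l m : (0 < l <= p)%N -> (0 < m <= q)%N ->
    [/\ (inord (j l) : 'I_n.+1) = j l :> nat, (inord (k m).-1 : 'I_n.+1) = (k m).-1 :> nat &
    \sum_((j l).+1 <= t < k m) simple_root n t =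
      eps (inord (j l)) - eps (inord (k m).-1) :> weight n].
  move=> /andP[l0 lp] /andP[m0 mq].
  have jl : (j l < i)%N by rewrite -(j_first hJ) (j_anti hJ) // ltnW.
  have km : (i < k m)%N by rewrite -(k_first hJ) (k_mono hJ) // ltnW.
  have kn : (k m < n.+1)%N by rewrite -(k_last hJ) (k_mono hJ).
  split; [by rewrite inordK //; lia|by rewrite inordK //; lia|].
  by apply: sum_simple_roots; lia.
have first e v : Pi_w R[i] i w a e -> is_w_eps R[i] i w a e v ->
     exists c : nat,
       [/\ is_codim i (schubert R[i] i v) (schubert R[i] i w) c,
           (3 <= c)%N &
           c = 3%N <->
           exists l m : nat,
             [/\ (0 < l <= p)%N, (0 < m <= q)%N, (l + m = a + 1)%N,
                 (j l - j l.+1 = 1)%N /\ (k m.+1 - k m = 1)%N &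
                 e = \sum_((j l).+1 <= t < k m) simple_root n t]].
  move=> Pe ve.
  have [L [M [x [y [Lp Mq LM [xE yE] eE]]]]] := Pi_w_corner hi gw ha hJ hw0 Pe.
  subst e; have cod := w_eps_codim hi gw ha hJ Lp Mq LM xE yE ve.
  have jL : (j L.+1 < j L)%N by apply: (j_anti hJ) => //; case/andP: Lp.
  have kM : (k M < k M.+1)%N by apply: (k_mono hJ) => //; case/andP: Mq.
  exists (1 + (j L - j L.+1) + (k M.+1 - k M))%N; split=> //; first by lia.
  split=> [c3|[l [m [lp mq lm [gj gk] E]]]].
    exists L, M; split=> //; first by split; lia.
    have [jE kE ->] := sumE L M Lp Mq.
    by congr (eps _ - eps _); apply: val_inj; rewrite /= ?jE ?kE.
  have [jE kE sE] := sumE l m lp mq; rewrite sE in E.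
  have nxy : x != y.
    have := corner_row hi hJ Lp Mq LM xE yE.
    have [iy _ _ _] := corner_column hi hJ Lp Mq LM xE yE.
    by rewrite -val_eqE /=; lia.
  have [xl ym] := rt_inj nxy E.
  have jl : j l = j L by rewrite -jE -xl.
  have lL : l = L.
    case: (ltngtP l L) => // lL.
      by have := j_anti hJ lL (leqW (proj2 (andP Lp))); rewrite jl ltnn.
    by have := j_anti hJ lL (leqW (proj2 (andP lp))); rewrite jl ltnn.
  have mM : m = M by lia.
  by rewrite -lL -mM gj gk.
split=> //; split=> [[e [v [Pe ve c3]]]|[l [m [lp mq lm [gj gk]]]]].
  have [c [cod _ [H _]]] := first e v Pe ve.
  have [l [m [lp mq lm g _]]] := H (is_codim_unique cod c3).
  by exists l, m.
have [jE kE _] := sumE l m lp mq.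
have [v ve] := w_eps_exists hi gw ha hJ lp mq lm jE kE gj gk.
exists (eps (inord (j l)) - eps (inord (k m).-1)), v; split=> //.
  exact: (Pi_w_of_corner hi hJ lp mq lm jE kE).
by have := w_eps_codim hi gw ha hJ lp mq lm jE kE ve; rewrite gj gk.
Qed.
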